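(* Let $G$ be a connected group of finite Morley rank in which, generically, elements belong to connected nilpotent subgroups. Suppose that $H$ is a definable connected generous subgroup of $G$, that $w\in N(H)\setminus H$ (that is, $w$ normalizes $H$ but is not in $H$) has finite order $n$ modulo $H$, and that $\{h^{n} : h\in H\}$ is generic in $H$. Then $C_{H}(w)$ is a proper subgroup of $H$.
   Context: Groups of finite Morley rank are equipped with the rank $\mathrm{rk}$ on definable sets (Borovik–Poizat axioms); ''definable'' means definable by a first-order formula, possibly with parameters and possibly in quotients by definable equivalence relations. The definable hull of a subset of $G$ is the smallest definable subgroup containing it. $G^\circ$ is the smallest definable subgroup of finite index of $G$; a definable group is connected if it equals its connected component, and an arbitrary subgroup is called connected if its definable hull is connected. A definable subset of a definable set $A$ is generic in $A$ if it has rank $\mathrm{rk}(A)$. A definable subset $X$ of $G$ is generous in $G$ if $X^G=\bigcup_{g\in G}X^g$ is generic in $G$, where $X^g=g^{-1}Xg$; a definable subgroup called generous, without further mention, is generous in $G$. $N(H)=\{g\in G : H^g=H\}$ and $C_H(w)=\{h\in H: hw=wh\}$. ''Generically, elements of $G$ belong to connected nilpotent subgroups'' means one of the following: either $G$ is saturated and the realizations in $G$ of the generic type (over some small set of parameters) each belong to a connected nilpotent subgroup of $G$; or (with no saturation assumption) $G$ has a definable generic subset, each of whose elements belongs to a connected nilpotent subgroup of $G$. *)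

(* Defs.v *)
From mathcomp Require Import all_boot.
From mathcomp Require Import boolp classical_sets functions cardinality.

Set Implicit Arguments.
Unset Strict Implicit.
Unset Printing Implicit Defensive.

Local Open Scope classical_set_scope.
Local Open Scope card_scope.
Local Open Scope group_scope.

(* First-order formulas.  The group operations are always available as symbols;
   [L] lists the additional symbols of the structure, so that [G] may be any
   expansion of a group. *)

Record language : Type := Language {
  fun_symb : Type;
  fun_arity : fun_symb -> nat;
  rel_symb : Type;
  rel_arity : rel_symb -> nat }.

Record interpretation (L : language) (G : Type) : Type := Interpretation {
  fun_interp : forall f : fun_symb L, (fun_arity f).-tuple G -> G;
  rel_interp : forall r : rel_symb L, (rel_arity r).-tuple G -> Prop }.

(* Formulas with [n] free variables and with parameters in the type [C].  In
   [FEx phi] the quantified variable is variable 0 of [phi] and the others are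
   shifted by one. *)

Inductive term (L : language) (C : Type) (n : nat) : Type :=
| TVar of 'I_n
| TParam of C
| TOne
| TInv of term L C n
| TMul of term L C n & term L C n
| TFun (f : fun_symb L) of ('I_(fun_arity f) -> term L C n).

Inductive formula (L : language) (C : Type) : nat -> Type :=
| FEq n of term L C n & term L C n : formula L C n
| FRel n (r : rel_symb L) of ('I_(rel_arity r) -> term L C n) : formula L C n
| FNot n of formula L C n : formula L C n
| FAnd n of formula L C n & formula L C n : formula L C n
| FEx n of formula L C n.+1 : formula L C n.

Section Definability.
Variables (G : groupType) (L : language) (I : interpretation L G).

Fixpoint eval (A : set G) n (t : term L A n) (e : n.-tuple G) : G :=
  match t with
  | TVar i => tnth e i
  | TParam a => val a
  | TOne => 1
  | TInv u => (eval u e)^-1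
  | TMul u v => eval u e * eval v e
  | TFun f us => fun_interp I [tuple eval (us i) e | i < fun_arity f]
  end.

Fixpoint holds (A : set G) n (phi : formula L A n) : n.-tuple G -> Prop :=
  match phi in formula _ _ n return n.-tuple G -> Prop with
  | FEq _ u v => fun e => eval u e = eval v e
  | FRel _ r us => fun e => rel_interp I [tuple eval (us i) e | i < rel_arity r]
  | FNot _ psi => fun e => ~ holds psi e
  | FAnd _ psi chi => fun e => holds psi e /\ holds chi e
  | FEx _ psi => fun e => exists x : G, holds psi [tuple of x :: e]
  end.

Definition definable_over (A : set G) n (X : set (n.-tuple G)) : Prop :=
  exists phi : formula L A n, X = [set e | holds phi e].

Definition definable n (X : set (n.-tuple G)) : Prop :=
  definable_over [set: G] X.

Definition definable_rel n m (R : n.-tuple G -> m.-tuple G -> Prop) : Prop :=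
  definable [set t : (n + m).-tuple G |
    exists (a : n.-tuple G) (b : m.-tuple G), t = [tuple of a ++ b] /\ R a b].

(* Sets definable in a quotient G^n / E: they are sets of E-classes, hence of
   type [set (set (n.-tuple G))]. *)

Definition equivalence n (E : n.-tuple G -> n.-tuple G -> Prop) : Prop :=
  [/\ forall a, E a a,
      forall a b, E a b -> E b a &
      forall a b c, E a b -> E b c -> E a c].

Definition interpretable n (X : set (set (n.-tuple G))) : Prop :=
  exists (E : n.-tuple G -> n.-tuple G -> Prop) (B : set (n.-tuple G)),
    [/\ equivalence E, definable_rel E, definable B &
        X = [set [set b | E a b] | a in B]].

(* Definability of a map between quotients is that of the relation it induces
   on representatives; the values of [f] outside [X] are irrelevant. *)
Definition definable_fun n m (X : set (set (n.-tuple G)))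
    (Y : set (set (m.-tuple G))) (f : set (n.-tuple G) -> set (m.-tuple G)) :
    Prop :=
  (forall x, X x -> Y (f x)) /\
  definable_rel (fun a b => exists x, [/\ X x, x a & f x b]).

Definition fiber n m (X : set (set (n.-tuple G)))
    (f : set (n.-tuple G) -> set (m.-tuple G)) (y : set (m.-tuple G)) :
    set (set (n.-tuple G)) :=
  [set x | X x /\ f x = y].

End Definability.

(* The Borovik-Poizat axioms.  The rank is only meaningful on nonempty sets, so
   nonemptiness is required wherever a rank is compared. *)

Definition rank_function (G : groupType) : Type :=
  forall n, set (set (n.-tuple G)) -> nat.

Record borovik_poizat (G : groupType) (L : language) (I : interpretation L G)
    (rk : rank_function G) : Prop := BorovikPoizat {
  rk_monotone : forall n (X : set (set (n.-tuple G))) (k : nat),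
    interpretable I X -> X !=set0 ->
    ((k.+1 <= rk n X)%N <->
     exists F : set (set (set (n.-tuple G))),
       [/\ infinite_set F,
           trivIset F id &
           forall Y, F Y ->
             [/\ interpretable I Y, Y `<=` X, Y !=set0 & (k <= rk n Y)%N]]);
  rk_definable : forall n m (X : set (set (n.-tuple G)))
      (Y : set (set (m.-tuple G))) f (k : nat),
    interpretable I X -> interpretable I Y -> definable_fun I X Y f ->
    interpretable I
      [set y | [/\ Y y, fiber X f y !=set0 & rk n (fiber X f y) = k]];
  rk_additive : forall n m (X : set (set (n.-tuple G)))
      (Y : set (set (m.-tuple G))) f (k : nat),
    interpretable I X -> interpretable I Y -> definable_fun I X Y f ->
    X !=set0 ->
    (forall y, Y y -> fiber X f y !=set0 /\ rk n (fiber X f y) = k) ->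
    rk n X = (rk m Y + k)%N;
  elim_infinite : forall n m (X : set (set (n.-tuple G)))
      (Y : set (set (m.-tuple G))) f,
    interpretable I X -> interpretable I Y -> definable_fun I X Y f ->
    exists k : nat, forall y, Y y -> `I_k #<= fiber X f y ->
      infinite_set (fiber X f y) }.

Section Groups.
Variable G : groupType.

Definition subgroup (H : set G) : Prop :=
  [/\ H 1, forall x y, H x -> H y -> H (x * y) & forall x, H x -> H x^-1].

Definition generated (X : set G) : set G := smallest subgroup X.

Definition finite_index (H K : set G) : Prop :=
  finite_set [set [set x * k | k in K] | x in H].

Definition conj_set (X : set G) (g : G) : set G := [set x ^ g | x in X].

Definition normalizer (H : set G) : set G := [set g | conj_set H g = H].

Definition centralizer_in (H : set G) (w : G) : set G :=
  [set h | H h /\ h * w = w * h].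

Definition nth_powers (H : set G) (n : nat) : set G := [set h ^+ n | h in H].

Definition has_order_mod (H : set G) (w : G) (n : nat) : Prop :=
  [/\ (0 < n)%N, H (w ^+ n) &
      forall m, (0 < m)%N -> (m < n)%N -> ~ H (w ^+ m)].

Fixpoint lower_central (K : set G) (n : nat) : set G :=
  if n is n'.+1
  then generated [set [~ x, y] | x in lower_central K n' & y in K]
  else K.

Definition nilpotent (K : set G) : Prop :=
  exists n, lower_central K n = [set 1].

End Groups.

Section RankedGroups.
Variables (G : groupType) (L : language) (I : interpretation L G).
Variable rk : rank_function G.

(* A subset of [G], first as a set of 1-tuples, then as a set of classes for
   equality on 1-tuples. *)
Definition tuples1 (X : set G) : set (1.-tuple G) := [set [tuple x] | x in X].

Definition definable1 (X : set G) : Prop := definable I (tuples1 X).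

Definition rank1 (X : set G) : nat := rk [set [set t] | t in tuples1 X].

Definition definable_subgroup (H : set G) : Prop := definable1 H /\ subgroup H.

Definition is_connected_component (H K : set G) : Prop :=
  [/\ definable_subgroup K, K `<=` H, finite_index H K &
      forall K', definable_subgroup K' -> K' `<=` H -> finite_index H K' ->
        K `<=` K'].

Definition definably_connected (H : set G) : Prop := is_connected_component H H.

Definition is_definable_hull (X K : set G) : Prop :=
  [/\ definable_subgroup K, X `<=` K &
      forall K', definable_subgroup K' -> X `<=` K' -> K `<=` K'].

Definition connected (K : set G) : Prop :=
  exists D, is_definable_hull K D /\ definably_connected D.

Definition generic_in (X A : set G) : Prop :=
  [/\ definable1 X, X `<=` A, X !=set0 & rank1 X = rank1 A].

Definition generous (X : set G) : Prop :=
  generic_in (\bigcup_(g in [set: G]) conj_set X g) [set: G].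

(* |A| < |G|. *)
Definition small (A : set G) : Prop := ~ ([set: G] #<= A).

Definition complete_type (A : set G) n (p : set (formula L A n)) : Prop :=
  (forall q, q `<=` p -> finite_set q ->
     exists e : n.-tuple G, forall phi, q phi -> holds I phi e) /\
  (forall phi, p phi \/ p (FNot phi)).

Definition realizes (A : set G) n (p : set (formula L A n)) (e : n.-tuple G) :
    Prop :=
  forall phi, p phi -> holds I phi e.

Definition saturated : Prop :=
  forall (A : set G) n (p : set (formula L A n)),
    small A -> complete_type p -> exists e, realizes p e.

(* This set of formulas is a complete type when [G] is connected. *)
Definition generic_type (A : set G) : set (formula L A 1) :=
  [set phi | generic_in [set x | holds I phi [tuple x]] [set: G]].

Definition in_connected_nilpotent (x : G) : Prop :=
  exists K : set G, [/\ subgroup K, connected K, nilpotent K & K x].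

Definition generically_connected_nilpotent : Prop :=
  (saturated /\
   exists A : set G, small A /\
     forall x, realizes (@generic_type A) [tuple x] ->
       in_connected_nilpotent x) \/
  (exists X : set G, generic_in X [set: G] /\
     forall x, X x -> in_connected_nilpotent x).

End RankedGroups.

(* Main.v *)
(* If [w] centralized [H], then [(w h)^n = w^n h^n] would show that the union [W]
   of the conjugates of [wH] maps under [x |-> x^n] onto a generic set, so that [W]
   would be generic.  Let [N] be the group generated by [H] and [w], a finite
   extension of [H].  Counting ranks, a generic [x] lies in only finitely many of
   the conjugates [N^g], seen as cosets [N g].  Let [x] be such an element of
   [(wH)^g] in a connected nilpotent group, with definable hull [D].  If [D] were
   not contained in [N^g], infinitely many elements of [D] modulo [D :&: N^g] would
   conjugate [x] into [N^g], by a normalizer argument in the nilpotent group [D].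
   So [D] is contained in [N^g], hence in [H^g] by connectedness, and
   [x] lies both in [H^g] and in [(wH)^g], which is absurd.  Any two generic sets
   meet in the connected group [G], hence such an [x] exists; in the saturated
   case one realizes the generic type over additional parameters. *)

Require Import Defs.
From mathcomp Require Import all_boot.
From mathcomp Require Import boolp classical_sets functions cardinality.

Set Implicit Arguments.
Unset Strict Implicit.
Unset Printing Implicit Defensive.

Local Open Scope classical_set_scope.
Local Open Scope card_scope.
Local Open Scope group_scope.

(** * Definability *)

(** The axioms mention no Morley degree, so the meeting of generic subsets of a connected group has
    to be built: a definable set of maximal rank contains a piece that cannot be split into two
    parts of that rank, and the elements translating this piece to itself up to smaller rank form a
    definable subgroup of finite index, hence the whole group. The ordinary normalizer condition
    would give only one new element of [D] normalizing a proper subgroup, whereas the coset count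
    needs infinitely many conjugators; connectedness of [D] supplies them, since finite sections of
    the central series can be absorbed. The power map is usable because [w ^+ n] lies in [H] and
    commutes with it: the elements [w ^+ n * h ^+ n] form a generic subset of [H] invariant under
    conjugation by [H], and such a subset inherits the generosity of [H]. *)

Lemma infinite_enum T (A : set T) : infinite_set A ->
  exists f : nat -> T, injective f /\ forall i, A (f i).
Proof.
elim/Ppointed: T => T in A *; first by move/infinite_setN0=> [x]; have := no x.
move/infiniteP/pcard_leP => -[f]; exists f; split=> [i j fij|i]; last exact: funS.
by apply: (@inj _ _ _ f) => //; rewrite inE.
Qed.

Lemma infinite_split (P : nat -> Prop) :
  (exists f : nat -> nat, injective f /\ forall i, P (f i)) \/
  (exists f : nat -> nat, injective f /\ forall i, ~ P (f i)).
Proof.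
have [fP|/infinite_enum] := pselect (finite_set [set i | P i]); last by left.
have [fN|/infinite_enum] := pselect (finite_set [set i | ~ P i]); last by right.
case: infinite_nat; have -> : [set: nat] = [set i | P i] `|` [set i | ~ P i].
  by apply/seteqP; split=> // i _; have [] := pselect (P i); [left|right].
by rewrite finite_setU.
Qed.

Section Definability.
Variables (G : groupType) (L : language) (I : interpretation L G).

Definition term_fun_over (A : set G) n (f : n.-tuple G -> G) :=
  exists t : term L A n, forall e, f e = eval I t e.

(** The parameter type of a term is the set [A] itself, so changing the set means rebuilding the
    term. The finite support [F] says over which sets this is possible; the saturated case relies on
    it. *)
Lemma term_params (A : set G) n (t : term L A n) :
  exists F : set G, [/\ finite_set F, F `<=` A &
    forall B, F `<=` B -> term_fun_over B (eval I t)].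
Proof.
elim: t => [i|a||u [F [fF FA IH]]|u [F [fF FA IHu]] v [F' [fF' FA' IHv]]|f us IH].
- by exists set0; split=> // B _; exists (TVar _ _ i).
- exists [set val a]; split=> [||B FB]; first exact: finite_set1.
    by move=> _ ->; apply: set_valP.
  by exists (TParam L n (exist _ (val a) (mem_set (FB _ erefl)))).
- by exists set0; split=> // B _; exists (TOne _ _ _).
- exists F; split=> // B /IH[u' e']; exists (TInv u') => e /=; by rewrite e'.
- exists (F `|` F'); split=> [||B FB]; first by rewrite finite_setU.
    by move=> x [/FA|/FA'].
  have [u' eu] := IHu B (fun x Fx => FB x (or_introl Fx)).
  have [v' ev] := IHv B (fun x Fx => FB x (or_intror Fx)).
  by exists (TMul u' v') => e /=; rewrite eu ev.
- have [F HF] := choice IH.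
  exists (\bigcup_(i in [set: 'I_(fun_arity f)]) F i); split.
  + by apply: bigcup_finite => [|i _]; [exact: finite_finset | have [] := HF i].
  + by move=> x [i _]; have [_ FA _] := HF i; apply: FA.
  + move=> B FB.
    have tB i : exists t : term L B n, forall e, eval I (us i) e = eval I t e.
      by have [_ _] := HF i; apply; move=> x Fx; apply: FB; exists i.
    have [ts ets] := choice tB.
    exists (TFun ts) => e /=; congr fun_interp.
    by apply: eq_from_tnth => i; rewrite !tnth_mktuple ets.
Qed.

Lemma formula_params (A : set G) n (phi : formula L A n) :
  exists F : set G, [/\ finite_set F, F `<=` A &
    forall B, F `<=` B -> definable_over I B [set e | holds I phi e]].
Proof.
elim: phi => {n} [n u v|n r us|n psi [F [fF FA IH]]
    |n psi [F [fF FA IH]] chi [F' [fF' FA' IH']]|n psi [F [fF FA IH]]].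
- have [F [fF FA IHu]] := term_params u; have [F' [fF' FA' IHv]] := term_params v.
  exists (F `|` F'); split=> [||B FB]; first by rewrite finite_setU.
    by move=> x [/FA|/FA'].
  have [u' eu] := IHu B (fun x Fx => FB x (or_introl Fx)).
  have [v' ev] := IHv B (fun x Fx => FB x (or_intror Fx)).
  by exists (FEq u' v'); apply: funext => e /=; rewrite eu ev.
- have [F HF] := choice (fun i => term_params (us i)).
  exists (\bigcup_(i in [set: 'I_(rel_arity r)]) F i); split.
  + by apply: bigcup_finite => [|i _]; [exact: finite_finset | have [] := HF i].
  + by move=> x [i _]; have [_ FA _] := HF i; apply: FA.
  + move=> B FB.
    have tB i : exists t : term L B n, forall e, eval I (us i) e = eval I t e.
      by have [_ _] := HF i; apply; move=> x Fx; apply: FB; exists i.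
    have [ts ets] := choice tB.
    exists (FRel ts); apply: funext => e /=; congr rel_interp.
    by apply: eq_from_tnth => i; rewrite !tnth_mktuple ets.
- exists F; split=> // B /IH[psi' e']; exists (FNot psi').
  by apply: funext => e /=; rewrite -[holds I psi' e]/([set e | holds I psi' e] e) -e'.
- exists (F `|` F'); split=> [||B FB]; first by rewrite finite_setU.
    by move=> x [/FA|/FA'].
  have [u' eu] := IH B (fun x Fx => FB x (or_introl Fx)).
  have [v' ev] := IH' B (fun x Fx => FB x (or_intror Fx)).
  exists (FAnd u' v'); apply: funext => e /=.
  by rewrite -[holds I u' e]/([set e | holds I u' e] e) -eu
    -[holds I v' e]/([set e | holds I v' e] e) -ev.
- exists F; split=> // B /IH[psi' e']; exists (FEx psi'); apply: funext => e /=.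
  apply: propext; split=> -[x hx]; exists x.
    by rewrite -[holds _ _ _]/([set e | holds I psi' e] _) -e'.
  by rewrite -[holds _ _ _]/([set e | holds I psi e] _) e'.
Qed.

(** Definability is tracked on functions and predicates rather than on syntax, so that closure
    properties compose without handling variables. All elements of [G] are allowed as parameters. *)
Definition tdef n (f : n.-tuple G -> G) := term_fun_over [set: G] f.
Definition pdef n (P : n.-tuple G -> Prop) := definable I [set e | P e].
Definition smap m n (s : m.-tuple G -> n.-tuple G) :=
  forall i, tdef (fun e => tnth (s e) i).

Lemma pdefE n (P Q : n.-tuple G -> Prop) :
  (forall e, P e <-> Q e) -> pdef P -> pdef Q.
Proof. by move=> PQ; congr definable; apply: funext => e; apply: propext. Qed.

Lemma tdefV n i : tdef (fun e : n.-tuple G => tnth e i).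
Proof. by exists (TVar _ _ i). Qed.

Lemma tdefC n x : tdef (fun e : n.-tuple G => x).
Proof. by exists (TParam L n (exist _ x (mem_set Logic.I))). Qed.

Lemma tdef_inv n (f : n.-tuple G -> G) : tdef f -> tdef (fun e => (f e)^-1).
Proof. by case=> t ft; exists (TInv t) => e /=; rewrite ft. Qed.

Lemma tdefM n (f g : n.-tuple G -> G) :
  tdef f -> tdef g -> tdef (fun e => f e * g e).
Proof. by case=> t ft [u gu]; exists (TMul t u) => e /=; rewrite ft gu. Qed.

Lemma tdefX n (f : n.-tuple G -> G) k : tdef f -> tdef (fun e => f e ^+ k).
Proof.
move=> df; elim: k => [|k IH].
  by under eq_fun do rewrite expg0; apply: tdefC.
by under eq_fun do rewrite expgS; apply: tdefM.
Qed.

Lemma tdef_comp n m (f : n.-tuple G -> G) (s : m.-tuple G -> n.-tuple G) :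
  tdef f -> smap s -> tdef (fun e => f (s e)).
Proof.
case=> t ft ds; suff [u tu] : tdef (fun e => eval I t (s e)).
  by exists u => e; rewrite ft tu.
elim: t {f ft} => [i|a||u IH|u IHu v IHv|f us IH] /=.
- exact: ds.
- exact: tdefC.
- by exists (TOne _ _ _).
- exact: tdef_inv.
- exact: tdefM.
- have [ts ets] := choice IH.
  exists (TFun ts) => e /=; congr fun_interp.
  by apply: eq_from_tnth => i; rewrite !tnth_mktuple ets.
Qed.

Lemma smap_comp k n m (s : m.-tuple G -> n.-tuple G) (r : k.-tuple G -> m.-tuple G) :
  smap s -> smap r -> smap (fun e => s (r e)).
Proof. by move=> ds dr i; exact: (tdef_comp (ds i) dr). Qed.

Lemma smap_behead n : smap (fun e : n.+1.-tuple G => [tuple of behead e]).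
Proof. by move=> i; under eq_fun do rewrite tnth_behead; apply: tdefV. Qed.

Lemma smap_cons n m (f : m.-tuple G -> G) (s : m.-tuple G -> n.-tuple G) :
  tdef f -> smap s -> smap (fun e => [tuple of f e :: s e]).
Proof.
move=> df ds i; case: (unliftP ord0 i) => [j ->|->].
  by under eq_fun do rewrite tnthS; apply: ds.
by under eq_fun do rewrite tnth0.
Qed.

Lemma smap_tuple n m (f : 'I_n -> m.-tuple G -> G) :
  (forall i, tdef (f i)) -> smap (fun e => [tuple f i e | i < n]).
Proof. by move=> df i; under eq_fun do rewrite tnth_mktuple. Qed.

Lemma pdef_eq n (f g : n.-tuple G -> G) : tdef f -> tdef g ->
  pdef (fun e => f e = g e).
Proof.
by case=> t ft [u gu]; exists (FEq t u); apply: funext => e /=; rewrite ft gu.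
Qed.

Lemma pdef_not n (P : n.-tuple G -> Prop) : pdef P -> pdef (fun e => ~ P e).
Proof.
case=> phi e1; exists (FNot phi); apply: funext => e /=.
by rewrite -[holds I phi e]/([set e | holds I phi e] e) -e1.
Qed.

Lemma pdef_and n (P Q : n.-tuple G -> Prop) : pdef P -> pdef Q ->
  pdef (fun e => P e /\ Q e).
Proof.
case=> phi e1 [psi e2]; exists (FAnd phi psi); apply: funext => e /=.
by rewrite -[holds I phi e]/([set e | holds I phi e] e) -e1
  -[holds I psi e]/([set e | holds I psi e] e) -e2.
Qed.

Lemma pdef_or n (P Q : n.-tuple G -> Prop) : pdef P -> pdef Q ->
  pdef (fun e => P e \/ Q e).
Proof.
move=> dP dQ; apply: pdefE (pdef_not (pdef_and (pdef_not dP) (pdef_not dQ))) => e.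
by rewrite -not_orE notK.
Qed.

Lemma pdef_impl n (P Q : n.-tuple G -> Prop) : pdef P -> pdef Q ->
  pdef (fun e => P e -> Q e).
Proof.
move=> dP dQ; apply: pdefE (pdef_or (pdef_not dP) dQ) => e.
by split=> [[]//|PQ]; have [/PQ|] := pselect (P e); [right|left].
Qed.

Lemma pdef_comp m n (P : n.-tuple G -> Prop) (s : m.-tuple G -> n.-tuple G) :
  pdef P -> smap s -> pdef (fun e => P (s e)).
Proof.
case=> phi e1 ds; have {e1} -> : P = holds I phi.
  by apply: funext => e; rewrite -[P e]/([set e | P e] e) e1.
elim: phi m s ds => {n P} [n u v|n r us|n psi IH|n psi IH chi IH'|n psi IH] m s ds /=.
- by apply: pdef_eq; apply: tdef_comp ds; [exists u | exists v].
- have tB i : exists t : term L [set: G] m,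
      forall e, eval I (us i) (s e) = eval I t e.
    by apply: tdef_comp ds; exists (us i).
  have [ts ets] := choice tB.
  exists (FRel ts); apply: funext => e /=; congr rel_interp.
  by apply: eq_from_tnth => i; rewrite !tnth_mktuple ets.
- by apply: pdef_not; apply: IH.
- by apply: pdef_and; [apply: IH | apply: IH'].
(* Below a quantifier the substitution keeps the bound variable 0 and acts on the remaining ones. *)
- have ds' : smap (fun e : m.+1.-tuple G =>
      [tuple of tnth e ord0 :: s [tuple of behead e]]).
    by apply: smap_cons; [apply: tdefV | apply: smap_comp (@smap_behead _)].
  have [chi e1] := IH _ _ ds'; exists (FEx chi); apply: funext => e /=.
  apply: propext; split=> -[x hx]; exists x.
    rewrite -[holds _ _ _]/([set e | holds I chi e] _) -e1 /= tnth0.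
    by have -> : [tuple of behead (x :: e)] = e by apply: val_inj.
  move: hx; rewrite -[holds _ _ _]/([set e | holds I chi e] _) -e1 /= tnth0.
  by have -> : [tuple of behead (x :: e)] = e by apply: val_inj.
Qed.

(** The premise ranges over every context, term and substitution, so that a tactic can remove nested
    quantifiers one after another. The proof instantiates it at variable 0 and the tail. *)
Lemma pdef_ex n (P : G -> n.-tuple G -> Prop) :
  (forall m (y : m.-tuple G -> G) (s : m.-tuple G -> n.-tuple G),
     tdef y -> smap s -> pdef (fun e => P (y e) (s e))) ->
  pdef (fun e => exists x, P x e).
Proof.
move=> /(_ _ _ _ (tdefV ord0) (@smap_behead n)) [phi e1].
exists (FEx phi); apply: funext => e /=; apply: propext; split=> -[x hx]; exists x.
  rewrite -[holds _ _ _]/([set e | holds I phi e] _) -e1 /= tnth0.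
  by have -> : [tuple of behead (x :: e)] = e by apply: val_inj.
move: hx; rewrite -[holds _ _ _]/([set e | holds I phi e] _) -e1 /= tnth0.
by have -> : [tuple of behead (x :: e)] = e by apply: val_inj.
Qed.

Lemma pdef_all n (P : G -> n.-tuple G -> Prop) :
  (forall m (y : m.-tuple G -> G) (s : m.-tuple G -> n.-tuple G),
     tdef y -> smap s -> pdef (fun e => P (y e) (s e))) ->
  pdef (fun e => forall x, P x e).
Proof.
move=> dP; apply: (@pdefE _ (fun e => ~ exists x, ~ P x e)) => [e|].
  by rewrite -forallNE; split=> h x; [apply: contrapT | move/(_ (h x))].
by apply/pdef_not/pdef_ex => m y s dy ds; apply/pdef_not/dP.
Qed.

Lemma pdef_all_ord n m (P : 'I_m -> n.-tuple G -> Prop) :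
  (forall i, pdef (P i)) -> pdef (fun e => forall i, P i e).
Proof.
elim: m P => [|m IH] P dP.
  apply: pdefE (pdef_eq (tdefC n 1) (tdefC n 1)) => e; split=> // _ [].
  by move=> ? [].
apply: pdefE (pdef_and (dP ord0) (IH _ (fun i => dP (lift ord0 i)))) => e.
split=> [[h0 h] i|h]; last by split.
by case: (unliftP ord0 i) => [j|] ->.
Qed.

Lemma pdef_teq n m (s r : m.-tuple G -> n.-tuple G) :
  smap s -> smap r -> pdef (fun e => s e = r e).
Proof.
move=> ds dr; apply: pdefE (pdef_all_ord (fun i => pdef_eq (ds i) (dr i))) => e.
by split=> [/eq_from_tnth|-> ].
Qed.

Lemma definable_relP n m (R : n.-tuple G -> m.-tuple G -> Prop) :
  pdef (fun e : (n + m).-tuple G =>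
    R [tuple tnth e (lshift m i) | i < n] [tuple tnth e (rshift n i) | i < m]) ->
  definable_rel I R.
Proof.
apply: pdefE => e; split=> [h|[a [b [-> ab]]]]; last first.
  have -> : [tuple tnth [tuple of a ++ b] (lshift m i) | i < n] = a.
    by apply: eq_from_tnth => i; rewrite tnth_mktuple tnth_lshift.
  have -> // : [tuple tnth [tuple of a ++ b] (rshift n i) | i < m] = b.
  by apply: eq_from_tnth => i; rewrite tnth_mktuple tnth_rshift.
do 2 eexists; split; last exact: h.
apply: eq_from_tnth => i; case: (fintype.splitP i) => j ij.
  have -> : i = lshift m j by apply: val_inj.
  by rewrite tnth_lshift tnth_mktuple.
have -> : i = rshift n j by apply: val_inj.
by rewrite tnth_rshift tnth_mktuple.
Qed.

End Definability.

(** * Rank *)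

Section Rank.
Variables (G : groupType) (L : language) (I : interpretation L G).
Variables (rk : rank_function G) (rkG : borovik_poizat I rk).

Definition classes n (X : set (n.-tuple G)) : set (set (n.-tuple G)) :=
  [set [set t] | t in X].

(** Lower bounds are the convenient form of the rank, because the first axiom determines them by
    recursion on [k]. Nonemptiness is included since the axioms leave the rank of the empty set
    arbitrary. *)
Definition rank_ge n (X : set (n.-tuple G)) k :=
  X !=set0 /\ (k <= rk (classes X))%N.

Lemma interpretable_classes n (X : set (n.-tuple G)) :
  definable I X -> interpretable I (classes X).
Proof.
move=> dX; exists (fun a b => a = b), X; split=> //.
- by split=> [a|a b ->|a b c -> ->].
- by apply/definable_relP/pdef_teq; apply: smap_tuple => i; apply: tdefV.
- by congr image; apply: funext => a; apply/seteqP; split.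
Qed.

(** The axioms return interpretable sets with an unknown equivalence and an unknown base. When all
    classes are singletons, the base is forced to be [X]. *)
Lemma definable_interpretable n (X : set (n.-tuple G)) (F : set (set (n.-tuple G))) :
  interpretable I F -> F = classes X -> definable I X.
Proof.
move=> [E [B [[Erefl _ _] _ dB ->]]] EX; suff -> : X = B by [].
have EB a : B a -> [set b | E a b] = [set a] /\ X a.
  move=> Ba; have : classes X [set b | E a b] by rewrite -EX; exists a.
  case=> c Xc ec; have : [set c] a by rewrite ec; exact: Erefl.
  by move=> /= ac; split; [rewrite -ec -ac | rewrite ac].
apply/seteqP; split=> [a Xa|a /EB[]//].
have : classes X [set a] by exists a.
rewrite -EX => -[b Bb eb]; have [e2 _] := EB b Bb.
have ab : [set a] b by rewrite -eb; exact: Erefl.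
by rewrite -(ab : b = a).
Qed.

Lemma classesP n (X : set (n.-tuple G)) a : classes X [set a] <-> X a.
Proof.
split=> [[b Xb /seteqP[h _]]|]; last by exists a.
by have <- : b = a by apply: (h b).
Qed.

Lemma sub_classes n (X : set (n.-tuple G)) F :
  F `<=` classes X -> F = classes [set t | F [set t]].
Proof.
move=> FX; apply/seteqP; split=> [c Fc|c [t Ft <-]//].
by have [t Xt et] := FX _ Fc; exists t => //=; rewrite et.
Qed.

Lemma classes_nonempty n (X : set (n.-tuple G)) : classes X !=set0 <-> X !=set0.
Proof. by split=> [[_ [t Xt _]]|[t Xt]]; [exists t | exists [set t]; exists t]. Qed.

Lemma classes_inj n : injective (@classes n).
Proof.
by move=> X Y XY; apply/seteqP; split=> t; rewrite -classesP -[in X in _ -> X]classesP XY.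
Qed.

(** A disjoint sequence is easier to thin out and modify than an infinite family of sets of classes;
    its terms are distinct because they are nonempty. *)
Lemma rank_geS n (X : set (n.-tuple G)) k : definable I X ->
  rank_ge X k.+1 <-> exists B : nat -> set (n.-tuple G),
    (forall i, [/\ definable I (B i), B i `<=` X & rank_ge (B i) k]) /\
    (forall i j x, B i x -> B j x -> i = j).
Proof.
move=> dX; split=> [[X0 kX]|[B [HB disB]]].
  have [F [infF triF HF]] := (rk_monotone rkG k (interpretable_classes dX)
    (iffRL (classes_nonempty X) X0)).1 kX.
  have [f [injf Ff]] := infinite_enum infF.
  exists (fun i => [set t | f i [set t]]); split=> [i|i j x ix jx].
    have [intf fX f0 kf] := HF _ (Ff i); have ef := sub_classes fX.
    split; first exact: definable_interpretable intf ef.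
      by move=> t /fX /classesP.
    split; last by rewrite -ef.
    by apply/classes_nonempty; rewrite -ef.
  by apply: injf; apply: triF; [exact: Ff | exact: Ff | exists [set x]].
have X0 : X !=set0.
  by have [_ BX [[t /BX Xt] _]] := HB 0%N; exists t.
split=> //; apply/(rk_monotone rkG k (interpretable_classes dX)).
  exact/classes_nonempty.
exists (range (fun i => classes (B i))); split.
- apply/infiniteP; rewrite -(card_le_eqr (card_esym (inj_card_eq _))) // => i j _ _.
  move=> /classes_inj eB; have [_ _ [[t Bt] _]] := HB i.
  by apply: disB (Bt) _; rewrite -eB.
- move=> _ _ [i _ <-] [j _ <-] [c [[t Bt <-] /classesP Bt']].
  by rewrite (disB _ _ _ Bt Bt').
- move=> _ [i _ <-]; have [dB BX [B0 kB]] := HB i; split=> //.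
  + exact: interpretable_classes.
  + by move=> _ [t /BX Xt <-]; exists t.
  + exact/classes_nonempty.
Qed.

Lemma rank_ge_leq n (X : set (n.-tuple G)) j k :
  (j <= k)%N -> rank_ge X k -> rank_ge X j.
Proof. by move=> jk [X0 /(leq_trans jk)]. Qed.

Lemma rank_ge_sub n (X Y : set (n.-tuple G)) k : definable I X -> definable I Y ->
  X `<=` Y -> rank_ge X k -> rank_ge Y k.
Proof.
case: k => [|k] dX dY XY; first by move=> [[t Xt] _]; split=> //; exists t; apply: XY.
move=> /(rank_geS _ dX)[B [HB disB]]; apply/(rank_geS _ dY); exists B; split=> // i.
by have [dB BX kB] := HB i; split=> // t /BX/XY.
Qed.

Lemma definableI n (X Y : set (n.-tuple G)) :
  definable I X -> definable I Y -> definable I (X `&` Y).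
Proof. exact: pdef_and. Qed.

(** Each of the disjoint pieces of the union keeps rank [k] on one side by induction, and one of the
    two sides receives infinitely many of them. *)
Lemma rank_geU n (X Y : set (n.-tuple G)) k : definable I X -> definable I Y ->
  rank_ge (X `|` Y) k -> rank_ge X k \/ rank_ge Y k.
Proof.
elim: k X Y => [|k IH] X Y dX dY.
  by move=> [[t [Xt|Yt]] _]; [left|right]; split=> //; exists t.
have dXY : definable I (X `|` Y) by apply: pdef_or.
move=> /(rank_geS _ dXY)[B [HB disB]].
have half i : rank_ge (B i `&` X) k \/ rank_ge (B i `&` Y) k.
  have [dB BX kB] := HB i; apply: IH; try exact: definableI.
  by rewrite -setIUr setIidl.
have [[f [injf Hf]]|[f [injf Hf]]] := infinite_split (fun i => rank_ge (B i `&` X) k).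
  left; apply/(rank_geS _ dX); exists (fun i => B (f i) `&` X); split=> [i|i j x].
    by have [dB _ _] := HB (f i); split=> //; apply: definableI.
  by move=> [ix _] [jx _]; apply/injf/(disB _ _ _ ix jx).
right; apply/(rank_geS _ dY); exists (fun i => B (f i) `&` Y); split=> [i|i j x].
  have [dB _ _] := HB (f i); split=> //; first exact: definableI.
  by case: (half (f i)) => // /(Hf i).
by move=> [ix _] [jx _]; apply/injf/(disB _ _ _ ix jx).
Qed.

Lemma rank_ge_cover n (X : set (n.-tuple G)) (Z : nat -> set (n.-tuple G)) N k :
  definable I X -> (forall j, definable I (Z j)) ->
  (forall t, X t -> exists2 j, (j < N)%N & Z j t) ->
  rank_ge X k -> exists2 j, (j < N)%N & rank_ge (X `&` Z j) k.
Proof.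
elim: N X => [|N IH] X dX dZ XZ kX.
  by have [[t /XZ[j]]] := kX.
have dZN := definableI dX (dZ N).
have dXN : definable I (X `&` ~` Z N) by apply: definableI => //; exact: pdef_not (dZ N).
have : rank_ge ((X `&` ~` Z N) `|` (X `&` Z N)) k.
  by rewrite -setIUr setUC setUv setIT.
move=> /(rank_geU dXN dZN)[|hN]; last by exists N.
move=> /(IH _ dXN dZ) [t [/XZ[j]]|j jN hj].
  by rewrite ltnS leq_eqVlt => /predU1P[->//|]; exists j.
exists j; first exact: ltnW.
apply: rank_ge_sub hj; try exact: definableI.
by apply: setSI => t [].
Qed.

Lemma rank_ge_subsingleton n (X : set (n.-tuple G)) k : definable I X ->
  (forall s t, X s -> X t -> s = t) -> rank_ge X k -> k = 0%N.
Proof.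
case: k => // k dX X1 /(rank_geS _ dX)[B [HB disB]].
have [_ BX [[s Bs] _]] := HB 0%N; have [_ BX' [[t Bt] _]] := HB 1%N.
have := disB 0%N 1%N s Bs.
by rewrite (X1 s t) ?Bt; [move/(_ Bt) | exact: BX | exact: BX'].
Qed.

Section Fibers.
Variables (n m : nat) (f : n.-tuple G -> m.-tuple G) (X : set (n.-tuple G)).
Hypotheses (df : smap I f) (dX : definable I X).

Definition tfiber t := [set e | X e /\ f e = t].

Lemma definable_tfiber t : definable I (tfiber t).
Proof. by apply: pdef_and => //; apply: pdef_teq => // i; apply: tdefC. Qed.

Lemma definable_fun_classes (Y : set (m.-tuple G)) : (forall e, X e -> Y (f e)) ->
  definable_fun I (classes X) (classes Y) (fun c => f @` c).
Proof.
move=> XY; split=> [_ [e Xe <-]|].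
  by exists (f e); [exact: XY | rewrite image_set1].
have -> : (fun a b => exists x, [/\ classes X x, x a & (f @` x) b]) =
    (fun a b => X a /\ f a = b).
  apply: funext => a; apply: funext => b; apply: propext; split.
    by move=> [_ [[e Xe <-] /= -> [_ -> <-]]].
  by move=> [Xa <-]; exists [set a]; split; [exists a | | exists a].
apply: definable_relP; apply: pdef_and.
  by apply: pdef_comp dX _; apply: smap_tuple => i; apply: tdefV.
apply: pdef_teq; last by apply: smap_tuple => i; apply: tdefV.
by apply: smap_comp df _; apply: smap_tuple => i; apply: tdefV.
Qed.

Lemma fiber_classes t : fiber (classes X) (fun c => f @` c) [set t] = classes (tfiber t).
Proof.
apply/seteqP; split=> [_ [[e Xe <-]]|_ [e [Xe et] <-]].
  rewrite image_set1 => /seteqP[/(_ (f e) erefl) et _].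
  by exists e.
by split; [exists e | rewrite image_set1 et].
Qed.

Definition fibers_of_rank k :=
  [set t | tfiber t !=set0 /\ rk (classes (tfiber t)) = k].

Lemma definable_fibers_of_rank k : definable I (fibers_of_rank k).
Proof.
have dT : definable I [set: m.-tuple G].
  by apply: pdefE (pdef_eq (tdefC I m 1) (tdefC I m 1)) => e; split.
have := rk_definable rkG k (interpretable_classes dX) (interpretable_classes dT)
  (definable_fun_classes (fun e _ => Logic.I)).
move/definable_interpretable; apply; apply/seteqP; split.
  move=> _ [[t _ <-]]; rewrite fiber_classes => /classes_nonempty ? ?.
  by exists t.
move=> _ [t [t0 tk] <-]; split; first by exists t.
  by rewrite fiber_classes; apply/classes_nonempty.
by rewrite fiber_classes.
Qed.

End Fibers.

Lemma rank_constant_fibers n m (f : n.-tuple G -> m.-tuple G)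
    (X : set (n.-tuple G)) (Z : set (m.-tuple G)) k :
  smap I f -> definable I X -> definable I Z -> X !=set0 ->
  (forall e, X e -> Z (f e)) ->
  (forall t, Z t -> fibers_of_rank f X k t) ->
  rk (classes X) = (rk (classes Z) + k)%N.
Proof.
move=> df dX dZ X0 XZ Zk.
apply: (rk_additive rkG (interpretable_classes dX) (interpretable_classes dZ)
  (definable_fun_classes df dX XZ)); first exact/classes_nonempty.
by move=> _ [t /Zk[t0 tk] <-]; rewrite fiber_classes; split=> //; apply/classes_nonempty.
Qed.

Lemma rank_piece n m (f : n.-tuple G -> m.-tuple G)
    (X : set (n.-tuple G)) (Z : set (m.-tuple G)) k :
  smap I f -> definable I X -> definable I Z -> Z !=set0 ->
  (forall t, Z t -> fibers_of_rank f X k t) ->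
  [/\ definable I (X `&` f @^-1` Z), X `&` f @^-1` Z !=set0 &
    rk (classes (X `&` f @^-1` Z)) = (rk (classes Z) + k)%N].
Proof.
move=> df dX dZ [t Zt] Zk.
have dXZ : definable I (X `&` f @^-1` Z).
  by apply: definableI => //; apply: pdef_comp dZ df.
have XZ0 : X `&` f @^-1` Z !=set0.
  by have [[e [Xe et]] _] := Zk t Zt; exists e; rewrite /= et.
split=> //; apply: (rank_constant_fibers df dXZ dZ XZ0); first by move=> e [].
move=> s Zs; have := Zk s Zs; rewrite /fibers_of_rank /=.
suff -> : tfiber f (X `&` f @^-1` Z) s = tfiber f X s by [].
apply/seteqP; split=> e [] /=; first by move=> [Xe _]; split.
by move=> Xe es; rewrite /tfiber /= es.
Qed.

(** Additivity requires fibres of constant rank. [Z] is therefore cut into the definable sets where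
    the fibre rank is exactly [i], and one of them still has rank at least [j]. *)
Lemma rank_fibers_ge n m (f : n.-tuple G -> m.-tuple G)
    (X : set (n.-tuple G)) (Z : set (m.-tuple G)) j k :
  smap I f -> definable I X -> definable I Z ->
  (forall t, Z t -> rank_ge (tfiber f X t) k) ->
  rank_ge Z j -> rank_ge X (j + k)%N.
Proof.
(* Fibres lie in [X], so its rank bounds the possible values of [i]. *)
move=> df dX dZ Zk jZ; pose N := (rk (classes X)).+1.
have cov t : Z t -> exists2 i, (i < N)%N & fibers_of_rank f X i t.
  move=> /Zk tk; exists (rk (classes (tfiber f X t))); last by case: tk.
  rewrite ltnS; suff [] : rank_ge X (rk (classes (tfiber f X t))) by [].
  apply: (@rank_ge_sub _ (tfiber f X t)) => //; first exact: definable_tfiber.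
    by move=> e [].
  by case: tk.
have [i _ ji] := rank_ge_cover dZ (definable_fibers_of_rank df dX) cov jZ.
have dZi := definableI dZ (definable_fibers_of_rank df dX i).
have [dXi Xi0 Xi] := rank_piece df dX dZi ji.1 (fun t Zt => Zt.2).
have ki : (k <= i)%N.
  by have [[t [/Zk tk [_ <-]]] _] := ji; case: tk.
apply: (@rank_ge_sub _ (X `&` f @^-1` (Z `&` fibers_of_rank f X i))) => //.
by split=> //; rewrite Xi leq_add //; case: ji.
Qed.

(** This time [X] is cut according to the rank of the fibre. The bound [i + j <= k] says without
    subtraction that fibres have rank at most [k - j]; on a piece of rank at least [k], additivity
    leaves at least [j] for the base. *)
Lemma rank_fibers_le n m (f : n.-tuple G -> m.-tuple G)
    (X : set (n.-tuple G)) (Z : set (m.-tuple G)) j k :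
  smap I f -> definable I X -> definable I Z ->
  (forall e, X e -> Z (f e)) ->
  (forall t i, rank_ge (tfiber f X t) i -> (i + j <= k)%N) ->
  rank_ge X k -> rank_ge Z j.
Proof.
move=> df dX dZ XZ Zk kX; pose N := k.+1.
have dF i := definable_fibers_of_rank df dX i.
have cov e : X e -> exists2 i, (i < N)%N & (f @^-1` fibers_of_rank f X i) e.
  move=> Xe; have te : tfiber f X (f e) !=set0 by exists e.
  exists (rk (classes (tfiber f X (f e)))); last by [].
  by rewrite ltnS; apply: leq_trans (leq_addr j _) (Zk (f e) _ _).
have [i _ ki] := rank_ge_cover dX (fun i => pdef_comp (dF i) df) cov kX.
have dZi := definableI dZ (dF i).
have Zi0 : Z `&` fibers_of_rank f X i !=set0.
  by have [[e [Xe ie]] _] := ki; exists (f e); split=> //; apply: XZ.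
have [dXi Xi0 Xi] := rank_piece df dX dZi Zi0 (fun t Zt => Zt.2).
have ij : (i + j <= k)%N.
  by have [t [_ [t0 ti]]] := Zi0; apply: (Zk t); split=> //; rewrite ti.
apply: (@rank_ge_sub _ (Z `&` fibers_of_rank f X i)) => //.
split=> //; rewrite -(leq_add2r i) -Xi addnC; apply: leq_trans ij _.
have -> : X `&` f @^-1` (Z `&` fibers_of_rank f X i) = X `&` f @^-1` fibers_of_rank f X i.
  by apply/seteqP; split=> e [Xe] /=; [move=> [] | split=> //; split=> //; apply: XZ].
by case: ki.
Qed.

Lemma rank_ge_inj n m (f : n.-tuple G -> m.-tuple G)
    (X : set (n.-tuple G)) (Z : set (m.-tuple G)) k :
  smap I f -> definable I X -> definable I Z -> (forall e, X e -> Z (f e)) ->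
  (forall d e, X d -> X e -> f d = f e -> d = e) -> rank_ge X k -> rank_ge Z k.
Proof.
move=> df dX dZ XZ fI; apply: rank_fibers_le => // t i ti.
rewrite (rank_ge_subsingleton (definable_tfiber df dX t) _ ti) // => d e [Xd <-] [Xe].
by move/esym/(fI _ _ Xd Xe).
Qed.

Lemma rank_ge_surj n m (f : n.-tuple G -> m.-tuple G)
    (X : set (n.-tuple G)) (Z : set (m.-tuple G)) k :
  smap I f -> definable I X -> definable I Z ->
  (forall t, Z t -> exists2 e, X e & f e = t) -> rank_ge Z k -> rank_ge X k.
Proof.
move=> df dX dZ fS kZ; rewrite -[k]addn0; apply: rank_fibers_ge kZ => // t /fS[e Xe et].
by split=> //; exists e.
Qed.

End Rank.

Ltac tdef_tac :=
  rewrite /commg /conjg /=;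
  repeat first
  [ assumption | apply: tdefV | apply: tdefC | apply: tdef_inv | apply: tdefX
  | apply: tdefM | (apply: tdef_comp; [|eassumption])
  | match goal with H : smap _ _ |- _ => exact: (H _) end ].

(** * Definability of subsets of the group and of binary relations *)

Section Sets.
Variables (G : groupType) (L : language) (I : interpretation L G).

Definition definable2 (P : G -> set G) :=
  pdef I (fun e : 2.-tuple G => P (tnth e ord0) (tnth e ord_max)).

Lemma tuples1E (X : set G) : tuples1 X = [set e | X (tnth e ord0)].
Proof.
apply/seteqP; split=> [_ [x Xx <-] //|e Xe]; exists (tnth e ord0) => //.
by apply: eq_from_tnth => i; rewrite ord1.
Qed.

Lemma definable1P (X : set G) :
  definable1 I X <-> pdef I (fun e : 1.-tuple G => X (tnth e ord0)).
Proof. by rewrite /definable1 tuples1E. Qed.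

Lemma pdef_app n (X : set G) (f : n.-tuple G -> G) :
  definable1 I X -> tdef I f -> pdef I (fun e => X (f e)).
Proof.
move=> /definable1P dX df.
have ds : smap I (fun e : n.-tuple G => [tuple f e]) by move=> i; rewrite ord1.
exact: pdefE (pdef_comp dX ds).
Qed.

Lemma definable1_setT : definable1 I [set: G].
Proof.
by apply/definable1P; apply: pdefE (pdef_eq (tdefC I 1 1) (tdefC I 1 1)) => e; split.
Qed.

Lemma smap_pair n (f g : n.-tuple G -> G) :
  tdef I f -> tdef I g -> smap I (fun e => [tuple f e; g e]).
Proof. by move=> df dg [[|[|//]] i]. Qed.

Lemma pdef_app2 n (P : G -> set G) (f g : n.-tuple G -> G) :
  definable2 P -> tdef I f -> tdef I g -> pdef I (fun e => P (f e) (g e)).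
Proof. by move=> dP df dg; apply: pdefE (pdef_comp dP (smap_pair df dg)). Qed.

Lemma pdef_ex_lt n (P : nat -> n.-tuple G -> Prop) N :
  (forall i, pdef I (P i)) -> pdef I (fun e => exists2 i, (i < N)%N & P i e).
Proof.
move=> dP; elim: N => [|N IH].
  apply: pdefE (pdef_not (pdef_eq (tdefC I n 1) (tdefC I n 1))) => e.
  by split=> [[]|[]].
apply: pdefE (pdef_or (dP N) IH) => e; split=> [[h|[i iN h]]|[i]].
- by exists N.
- by exists i => //; apply: ltnW.
- by rewrite ltnS leq_eqVlt => /predU1P[->|iN] h; [left | right; exists i].
Qed.

End Sets.

Ltac pdef_tac :=
  lazymatch goal with
  | |- pdef _ (fun e => @?P e /\ @?Q e) => apply: pdef_and; pdef_tac
  | |- pdef _ (fun e => @?P e \/ @?Q e) => apply: pdef_or; pdef_tac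
  | |- pdef _ (fun e => ~ @?P e) => apply: pdef_not; pdef_tac
  | |- pdef _ (fun e => @?f e = @?g e) => apply: pdef_eq; tdef_tac
  | |- pdef _ (fun e => @?P e -> @?Q e) => apply: pdef_impl; pdef_tac
  | |- pdef _ (fun e => exists x, @?P x e) =>
      apply: (pdef_ex (P := P)) => ? ? ? ? ? /=; pdef_tac
  | |- pdef _ (fun e => forall x, @?P x e) =>
      apply: (pdef_all (P := P)) => ? ? ? ? ? /=; pdef_tac
  | H : definable1 _ ?X |- pdef _ (fun e => ?X (@?f e)) =>
      apply: (pdef_app (f := f) H); tdef_tac
  | H : definable2 _ ?P |- pdef _ (fun e => ?P (@?f e) (@?g e)) =>
      apply: (pdef_app2 (f := f) (g := g) H); tdef_tac
  end.

Ltac def_tac :=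
  first [apply/definable1P | idtac];
  rewrite /definable2 /setI /setU /setD /setC /= /mkset; pdef_tac.

(** * Rank of subsets of the group and of binary relations *)

Section SetRank.
Variables (G : groupType) (L : language) (I : interpretation L G).
Variables (rk : rank_function G) (rkG : borovik_poizat I rk).

Definition rank1_ge (X : set G) k := rank_ge rk (tuples1 X) k.

Definition rank2_ge (P : G -> set G) k :=
  rank_ge rk [set e : 2.-tuple G | P (tnth e ord0) (tnth e ord_max)] k.

Lemma rank1_geE (X : set G) k :
  rank1_ge X k <-> X !=set0 /\ (k <= rank1 rk X)%N.
Proof.
rewrite /rank1_ge /rank_ge; split=> -[[x Xx] kX]; split=> //.
  by case: Xx => y Xy _; exists y.
by exists [tuple x]; exists x.
Qed.

Lemma rank1_ge_leq (X : set G) j k : (j <= k)%N -> rank1_ge X k -> rank1_ge X j.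
Proof. exact: rank_ge_leq. Qed.

Lemma rank1_ge_sub (X Y : set G) k : definable1 I X -> definable1 I Y ->
  X `<=` Y -> rank1_ge X k -> rank1_ge Y k.
Proof. by move=> dX dY XY; apply: (rank_ge_sub rkG dX dY); apply: image_subset. Qed.

Lemma rank1_geU (X Y : set G) k : definable1 I X -> definable1 I Y ->
  rank1_ge (X `|` Y) k -> rank1_ge X k \/ rank1_ge Y k.
Proof.
by move=> dX dY; rewrite /rank1_ge /tuples1 image_setU; apply: (rank_geU rkG).
Qed.

Lemma rank1_geU_sub (X Y Z : set G) k :
  definable1 I X -> definable1 I Y -> definable1 I Z -> Z `<=` X `|` Y ->
  rank1_ge Z k -> rank1_ge X k \/ rank1_ge Y k.
Proof.
move=> dX dY dZ ZXY kZ; apply: rank1_geU => //; apply: rank1_ge_sub kZ => //.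
by def_tac.
Qed.

Lemma rank1_ge_cover (X : set G) (Z : nat -> set G) N k :
  definable1 I X -> (forall j, definable1 I (Z j)) ->
  (forall x, X x -> exists2 j, (j < N)%N & Z j x) ->
  rank1_ge X k -> exists2 j, (j < N)%N & rank1_ge (X `&` Z j) k.
Proof.
move=> dX dZ XZ kX.
have cov t : tuples1 X t -> exists2 j, (j < N)%N & tuples1 (Z j) t.
  by move=> [x /XZ[j jN Zx] <-]; exists j => //; exists x.
have [j jN kj] := rank_ge_cover rkG dX dZ cov kX.
exists j => //; rewrite /rank1_ge (_ : tuples1 _ = tuples1 X `&` tuples1 (Z j)) //.
by rewrite !tuples1E.
Qed.

Lemma rank1_geS (X : set G) k (B : nat -> set G) : definable1 I X ->
  (forall i, [/\ definable1 I (B i), B i `<=` X & rank1_ge (B i) k]) ->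
  (forall i j x, B i x -> B j x -> i = j) -> rank1_ge X k.+1.
Proof.
move=> dX HB disB; apply/(rank_geS rkG _ dX); exists (fun i => tuples1 (B i)).
split=> [i|i j _ [x ix <-]]; last by rewrite tuples1E => jx; apply: disB ix jx.
by have [dB BX kB] := HB i; split=> //; apply: image_subset.
Qed.

Lemma rank1_subsingleton (X : set G) k : definable1 I X ->
  (forall x y, X x -> X y -> x = y) -> rank1_ge X k -> k = 0%N.
Proof.
move=> dX X1; apply: (rank_ge_subsingleton rkG dX) => _ _ [x Xx <-] [y Xy <-].
by rewrite (X1 x y).
Qed.

Let fst2 (e : 2.-tuple G) := [tuple tnth e ord0].
Let snd2 (e : 2.-tuple G) := [tuple tnth e ord_max].

Let smap_fst2 : smap I fst2. Proof. by move=> i; rewrite ord1; apply: tdefV. Qed.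
Let smap_snd2 : smap I snd2. Proof. by move=> i; rewrite ord1; apply: tdefV. Qed.

Lemma eq_tuple2 (d e : 2.-tuple G) :
  tnth d ord0 = tnth e ord0 -> tnth d ord_max = tnth e ord_max -> d = e.
Proof.
move=> e0 e1; apply: eq_from_tnth => -[[|[|//]] i].
  by have -> : Ordinal i = ord0 by apply: val_inj.
by have -> : Ordinal i = ord_max by apply: val_inj.
Qed.

Section Relation.
Variable P : G -> set G.
Hypothesis dP : definable2 I P.

Let X := [set e : 2.-tuple G | P (tnth e ord0) (tnth e ord_max)].

Lemma definable_section y : definable1 I (P y).
Proof. by def_tac. Qed.

Lemma rank_section y k : rank_ge rk (tfiber fst2 X [tuple y]) k <-> rank1_ge (P y) k.
Proof.
have dX : definable I (tfiber fst2 X [tuple y]) by apply: definable_tfiber.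
have dY := definable_section y.
have eX e : tfiber fst2 X [tuple y] e <-> P y (tnth e ord_max) /\ tnth e ord0 = y.
  split=> [[Pe /(congr1 val) [ey]]|[Pe ey]].
    by split=> //; rewrite -ey.
  by rewrite /tfiber /X /fst2 /= ey.
split.
  apply: (rank_ge_inj rkG (f := snd2)) => // [e /eX[Pe _]|d e /eX[_ dy] /eX[_ ey]].
    by rewrite tuples1E.
  move=> /(congr1 (fun t => tnth t ord0)) /= de.
  by apply: eq_tuple2 => //; rewrite dy.
apply: (rank_ge_surj rkG (f := snd2)) => // _ [x Px <-].
by exists [tuple y; x] => //; apply/eX.
Qed.

Lemma rank2_fibers_ge (Z : set G) j k : definable1 I Z ->
  (forall y, Z y -> rank1_ge (P y) k) -> rank1_ge Z j -> rank2_ge P (j + k)%N.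
Proof.
move=> dZ Zk; apply: (rank_fibers_ge rkG (f := fst2)) => // _ [y /Zk yk <-].
exact/rank_section.
Qed.

Lemma rank2_fibers_le (Z : set G) j k : definable1 I Z ->
  (forall y x, P y x -> Z y) ->
  (forall y i, rank1_ge (P y) i -> (i + j <= k)%N) ->
  rank2_ge P k -> rank1_ge Z j.
Proof.
move=> dZ PZ Pk; apply: (rank_fibers_le rkG (f := fst2)) => // [e|t i].
  by move/PZ; rewrite tuples1E.
have -> : t = [tuple tnth t ord0] by apply: eq_from_tnth => l; rewrite ord1.
by move/rank_section/Pk.
Qed.

(** The rank of a section is at most that of the whole relation, so the condition is a finite
    disjunction of instances of the second axiom. This makes stabilizers up to smaller rank
    definable. *)
Lemma definable_rank1_ge k : definable1 I [set y | rank1_ge (P y) k].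
Proof.
apply/definable1P; pose N := (rk (classes X)).+1.
have dF i : definable I (fibers_of_rank rk fst2 X i) by apply: definable_fibers_of_rank.
pose Q i (e : 1.-tuple G) := (k <= i)%N /\ fibers_of_rank rk fst2 X i e.
have dQ i : pdef I (Q i).
  rewrite /Q; case: (k <= i)%N.
    by apply: pdefE (dF i) => e; split=> [|[]].
  apply: pdefE (pdef_not (pdef_eq (tdefC I 1 1) (tdefC I 1 1))) => e.
  by split=> [[]|[]].
apply: pdefE (pdef_ex_lt N dQ) => e.
have -> : e = [tuple tnth e ord0] by apply: eq_from_tnth => l; rewrite ord1.
rewrite -/(tnth e ord0) /=; set y := tnth e ord0.
split=> [[i iN [ki [F0 Fi]]]|/rank_section yk].
  by apply/rank_section; split=> //; rewrite Fi.
exists (rk (classes (tfiber fst2 X [tuple y]))); last by case: yk.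
rewrite ltnS; suff [] : rank_ge rk X (rk (classes (tfiber fst2 X [tuple y]))) by [].
apply: (@rank_ge_sub _ _ _ _ rkG _ (tfiber fst2 X [tuple y])) => //.
- exact: definable_tfiber.
- by move=> ? [].
- by case: yk.
Qed.

Lemma rank2_swap k : rank2_ge P k -> rank2_ge (fun x y => P y x) k.
Proof.
pose f (e : 2.-tuple G) := [tuple tnth e ord_max; tnth e ord0].
have df : smap I f by apply: smap_pair; apply: tdefV.
apply: (rank_ge_surj rkG (f := f)) => //.
  by apply: pdef_app2 => //; apply: tdefV.
by move=> e Pe; exists (f e) => //; apply: eq_tuple2.
Qed.

End Relation.

(** Double counting on the graph: its fibres over [Y] are nonempty, so its rank is at least that of
    [Y], while its fibres over [X] have at most one point. *)
Lemma rank1_ge_image (X Y : set G) (R : G -> set G) k :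
  definable1 I X -> definable1 I Y -> definable2 I R ->
  (forall x y y', R x y -> R x y' -> y = y') ->
  (forall y, Y y -> exists2 x, X x & R x y) ->
  rank1_ge Y k -> rank1_ge X k.
Proof.
move=> dX dY dR funR sur kY.
pose P x := [set y | [/\ X x, R x y & Y y]].
have dP : definable2 I P.
  by apply: pdefE (_ : pdef I (fun e : 2.-tuple G => (X (tnth e ord0) /\
    R (tnth e ord0) (tnth e ord_max)) /\ Y (tnth e ord_max))) => [e|];
    [split=> [[[]]|[]] | pdef_tac].
have dP' : definable2 I (fun y x => P x y).
  by apply: (pdef_app2 dP); apply: tdefV.
have kP : rank2_ge P (k + 0)%N.
  apply: (rank2_swap dP'); apply: rank2_fibers_ge dY _ kY => // y Yy.
  have [x Xx Rxy] := sur y Yy; apply/rank1_geE; split=> //.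
  by exists x.
rewrite addn0 in kP; apply: rank2_fibers_le kP => // [y x []//|y i yi].
rewrite (rank1_subsingleton (definable_section dP y) _ yi) // => x x' [_ r _] [_ r' _].
exact: funR r r'.
Qed.

End SetRank.

(** * Generic subsets of connected groups *)

(** Rank arguments produce a collision between two terms of a sequence rather than a bound on the
    number of cosets. *)
Lemma finite_index_seq (G : groupType) (H K : set G) : subgroup K ->
  (forall h : nat -> G, (forall i, H (h i)) ->
    exists i j, i <> j /\ K ((h i)^-1 * h j)) ->
  finite_index H K.
Proof.
move=> [K1 KM KV] seqK; apply: contrapT => /infinite_enum[c [injc Hc]].
have {}Hc i : exists h, H h /\ [set h * k | k in K] = c i.
  by have [h Hh ch] := Hc i; exists h.
have [h Hh] := choice Hc.
have [i [j [ij Kij]]] := seqK h (fun i => (Hh i).1).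
apply: ij; apply: injc; have [_ <-] := Hh i; have [_ <-] := Hh j.
apply/seteqP; split=> _ [k Kk <-].
  exists (((h i)^-1 * h j)^-1 * k); first by apply: KM => //; apply: KV.
  by rewrite invgM invgK -mulgA mulVKg.
by exists ((h i)^-1 * h j * k); [apply: KM | rewrite !mulgA mulgV mul1g].
Qed.

Lemma finite_index_map (G : groupType) T (H K : set G) (f : G -> T) :
  subgroup K -> finite_set [set f x | x in H] ->
  (forall x y, H x -> H y -> f x = f y -> K (x^-1 * y)) -> finite_index H K.
Proof.
move=> sK finf fK; apply: finite_index_seq => // h Hh.
apply: contrapT => injh; apply: (iffRL (infiniteP _)) finf.
have injfh : injective (fun i => f (h i)).
  move=> i j /fK K_ij; apply: contrapT => ij; apply: injh.
  by exists i, j; split=> //; exact: K_ij.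
rewrite -(card_le_eql (inj_card_eq (f := fun i => f (h i)) _)); last first.
  by move=> i j _ _ /injfh.
by apply: subset_card_le => _ [i _ <-]; exists (h i).
Qed.

Section GenericSets.
Variables (G : groupType) (L : language) (I : interpretation L G).
Variables (rk : rank_function G) (rkG : borovik_poizat I rk).

Local Notation rank1_ge := (rank1_ge rk).
Local Notation rank2_ge := (rank2_ge rk).
Local Notation definable1 := (definable1 I).
Local Notation definable2 := (definable2 I).

Lemma rank1_ge_map (f : G -> G) (X Y : set G) k :
  tdef I (fun e : 1.-tuple G => f (tnth e ord0)) ->
  definable1 X -> definable1 Y ->
  (forall y, Y y -> exists2 x, X x & f x = y) -> rank1_ge Y k -> rank1_ge X k.
Proof.
move=> df dX dY sur; apply: (rank1_ge_image rkG (R := fun x y => f x = y)) => //.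
  apply: pdef_eq; last exact: tdefV.
  have ds : smap I (fun e : 2.-tuple G => [tuple tnth e ord0]).
    by move=> i; rewrite ord1; apply: tdefV.
  exact: tdef_comp df ds.
by move=> x y y' <-.
Qed.

Lemma rank2_geU_sub (P Q R : G -> set G) k :
  definable2 P -> definable2 Q -> definable2 R ->
  (forall x y, R x y -> P x y \/ Q x y) -> rank2_ge R k ->
  rank2_ge P k \/ rank2_ge Q k.
Proof.
move=> dP dQ dR RPQ kR; apply: (rank_geU rkG) => //.
apply: (rank_ge_sub rkG) kR => //; first exact: pdef_or.
by move=> e /RPQ.
Qed.

(** If all intersections had rank below [r], each [A i] would keep rank [r] after removal of the
    earlier sets, and these remainders would be infinitely many disjoint subsets of [X], giving it
    rank [r.+1]. *)
Lemma almost_disjoint_family (X : set G) (A : nat -> set G) r :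
  definable1 X -> ~ rank1_ge X r.+1 ->
  (forall i, [/\ definable1 (A i), A i `<=` X & rank1_ge (A i) r]) ->
  exists i j, i <> j /\ rank1_ge (A i `&` A j) r.
Proof.
move=> dX rX HA; apply: contrapT => disA; apply: rX.
pose B i := [set x | A i x /\ ~ exists2 j, (j < i)%N & A j x].
have dA i : definable1 (A i) by have [] := HA i.
have dB i : definable1 (B i).
  apply/definable1P; apply: pdef_and; first exact/definable1P.
  by apply/pdef_not/pdef_ex_lt => j; apply/definable1P.
apply: (rank1_geS rkG (B := B)) => // [i|i j x [ix ni] [jx nj]]; last first.
  case: (ltngtP i j) => // ij; [case: nj; exists i | case: ni; exists j] => //.
have [_ AX rA] := HA i; split=> //; first by move=> x [/AX].
(* [A i] is covered by the earlier sets and, at index [i], by what remains of it. *)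
pose Z j := if (j < i)%N then A j else B i.
have dZ j : definable1 (Z j) by rewrite /Z; case: ifP.
have [x ix|j] := rank1_ge_cover rkG (N := i.+1) (dA i) dZ _ rA.
  have [[j ji jx]|nj] := pselect (exists2 j, (j < i)%N & A j x).
    by exists j; [exact: ltnW | rewrite /Z ji].
  by exists i; rewrite // /Z ltnn.
rewrite ltnS leq_eqVlt /Z => /predU1P[->|ji].
  rewrite ltnn; apply: (rank1_ge_sub rkG) => //.
  by have dAi := dA i; have dBi := dB i; def_tac.
rewrite ji => rij; case: disA; exists i, j; split=> // eij.
by rewrite eij ltnn in ji.
Qed.

(** For a definable set of rank [r] this is Morley degree one. *)
Definition indecomposable (A : set G) r :=
  forall B, definable1 B -> rank1_ge (A `&` B) r -> ~ rank1_ge (A `\` B) r.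

(** Otherwise splitting never stops: putting one half aside at each stage yields a disjoint sequence
    of sets of rank [r]. *)
Lemma indecomposable_subset (X : set G) r :
  definable1 X -> rank1_ge X r -> ~ rank1_ge X r.+1 ->
  exists A, [/\ definable1 A, A `<=` X, rank1_ge A r & indecomposable A r].
Proof.
move=> dX kX rX; apply: contrapT => noA; apply: rX.
pose good A := [/\ definable1 A, A `<=` X & rank1_ge A r].
have splitA A : exists B, good A ->
    [/\ definable1 B, rank1_ge (A `&` B) r & rank1_ge (A `\` B) r].
  have [[dA AX kA]|bad] := pselect (good A); last by exists A => /bad.
  apply: contrapT => noB; apply: noA; exists A; split=> // B dB AB AB'.
  by apply: noB; exists B.
have [sp Hsp] := choice splitA.
pose A i := iter i (fun A => A `\` sp A) X.
have goodA i : good (A i).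
  elim: i => [|i IH]; first by split.
  have [dA AX _] := IH; have [dB _ AB] := Hsp _ IH; split=> //.
    by rewrite /A iterS -/(A i); def_tac.
  by move=> x [/AX].
have decA i j x : (i <= j)%N -> A j x -> A i x.
  elim: j => [|j IH]; rewrite leq_eqVlt => /predU1P[->//|]; rewrite // ltnS => ij.
  by case=> /(IH ij).
have disj i j x : (i < j)%N -> A j x -> ~ sp (A i) x.
  by move=> ij /(decA i.+1 _ _ ij)[].
apply: (rank1_geS rkG (B := fun i => A i `&` sp (A i))) => // [i|i j x [ix si] [jx sj]].
  have [dA AX _] := goodA i; have [dB AB _] := Hsp _ (goodA i); split=> //.
    by def_tac.
  by move=> x [/AX].
by case: (ltngtP i j) => // /disj; [move/(_ _ jx) | move/(_ _ ix)].
Qed.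

Section ConnectedGroup.
Variables (H : set G) (r : nat).
Hypotheses (defH : definable_subgroup I H) (connH : definably_connected I H).
Hypotheses (rH : ~ rank1_ge H r.+1).

(** The set [S] of the proof is the stabilizer of [A] up to smaller rank. It is definable because
    rank is, and has finite index because infinitely many translates of [A] cannot be almost
    disjoint inside [H]; connectedness then makes it [H]. *)
Lemma indecomposable_left_invariant (A : set G) g :
  definable1 A -> A `<=` H -> rank1_ge A r -> indecomposable A r -> H g ->
  ~ rank1_ge [set x | A x /\ ~ A (g * x)] r.
Proof.
move=> dA AH rA indA Hg; have [dH [H1 HM HV]] := defH.
pose T g := [set x | A x /\ A (g * x)]; pose T' g := [set x | A x /\ ~ A (g * x)].
have dT h : definable1 (T h) by rewrite /T; def_tac.
have dT' h : definable1 (T' h) by rewrite /T'; def_tac.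
have TT' h : rank1_ge (T h) r -> ~ rank1_ge (T' h) r.
  by apply: (indA [set x | A (h * x)]); def_tac.
suff : rank1_ge (T g) r by exact: TT'.
pose S := [set h | H h /\ rank1_ge (T h) r].
suff HS : H `<=` S by have [] := HS g Hg.
have dT2 : definable2 T by rewrite /T; def_tac.
have dS : definable1 S.
  have := definable_rank1_ge rkG dT2 r; set R := mkset _ => dR.
  by have -> : S = H `&` R by []; def_tac.
have trT h (X Y : set G) : definable1 X -> definable1 Y ->
    (forall y, Y y -> X (h * y)) -> rank1_ge Y r -> rank1_ge X r.
  move=> dX dY XY; apply: (rank1_ge_map (f := fun x => h^-1 * x)) => //.
    by tdef_tac.
  by move=> y /XY Xy; exists (h * y); rewrite ?mulKg.
have SV h : S h -> S h^-1.
  move=> [Hh Th]; split; first exact: HV.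
  by apply: (trT h) Th => // y [Ay Ahy]; split; rewrite ?mulKg.
have SM h k : S h -> S k -> S (h * k).
  move=> [Hh Th] [Hk Tk]; split; first exact: HM.
  (* For [x] in [T k], either [h * k * x] is in [A] or [k * x] lies in the small set [T' h]. *)
  have dU : definable1 [set x | A (k * x) /\ ~ A (h * (k * x))] by def_tac.
  have [x [Ax Akx]||] // := rank1_geU_sub rkG (dT (h * k)) dU (dT k) _ Tk.
    have [Ahk|nA] := pselect (A (h * k * x)); [by left | right].
    by split=> //; rewrite mulgA.
  by move=> rU; case: (TT' h Th); apply: (trT k) rU => // y [].
have sS : subgroup S.
  split=> //; split=> //; have -> // : T 1 = A.
  by apply/seteqP; split=> x; rewrite /T /= mul1g; [case|].
have [_ _ _ minH] := connH; apply: minH => //; first by move=> x [].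
apply: finite_index_seq => // h Hh.
have [i [j [ij rij]]] : exists i j, i <> j /\
    rank1_ge ([set x | A ((h i)^-1 * x)] `&` [set x | A ((h j)^-1 * x)]) r.
  apply: (almost_disjoint_family (A := fun i => [set x | A ((h i)^-1 * x)]) dH rH) => i.
  split; first by def_tac.
    by move=> x /AH /(HM _ _ (Hh i)); rewrite mulVKg.
  by apply: (trT (h i)) rA => // [|y]; [def_tac | rewrite /= mulKg].
exists j, i; split; first by move=> ji; apply: ij.
split; first by apply: HM => //; apply: HV.
apply: (trT (h i)^-1) rij => //; first by def_tac.
by move=> y [iy jy]; split=> //; rewrite -mulgA mulVKg.
Qed.

(** Inversion exchanges the two sides and preserves rank and indecomposability. *)
Lemma indecomposable_right_invariant (A : set G) g :
  definable1 A -> A `<=` H -> rank1_ge A r -> indecomposable A r -> H g ->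
  ~ rank1_ge [set x | A x /\ ~ A (x * g)] r.
Proof.
move=> dA AH rA indA Hg rg; have [dH [H1 HM HV]] := defH.
have invT (X Y : set G) : definable1 X -> definable1 Y ->
    (forall y, Y y -> X y^-1) -> rank1_ge Y r -> rank1_ge X r.
  move=> dX dY XY; apply: (rank1_ge_map (f := fun x => x^-1)) => //.
    by tdef_tac.
  by move=> y /XY Xy; exists y^-1; rewrite ?invgK.
pose B := [set x | A x^-1].
have dB : definable1 B by rewrite /B; def_tac.
apply: (@indecomposable_left_invariant B g^-1) => //.
- by move=> x /AH /HV; rewrite invgK.
- by apply: invT rA => // y Ay; rewrite /B /= invgK.
- move=> C dC BC BC'; have dC' : definable1 [set x | C x^-1] by def_tac.
  apply: (indA _ dC').
    by apply: invT BC; [def_tac | def_tac | move=> y [By Cy]; split; rewrite /= ?invgK].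
  by apply: invT BC'; [def_tac | def_tac | move=> y [By Cy]; split; rewrite /= ?invgK].
- exact: HV.
apply: invT rg; [rewrite /B; def_tac | by def_tac |].
by move=> y [Ay nA]; split; rewrite /B /= ?invgK // invgM !invgK.
Qed.

(** Take degree-one pieces [A] of [X] and [B] of [Y], and a product [g * x] with [g] in [B] and [x]
    in [A]. For fixed [g] it is in [A] for almost all [x]; for fixed [x] it is in [B] for almost all
    [g]. The exceptional pairs have rank below [r + r], so some product is in both. *)
Lemma generic_meet (X Y : set G) : definable1 X -> definable1 Y ->
  X `<=` H -> Y `<=` H -> rank1_ge X r -> rank1_ge Y r -> X `&` Y !=set0.
Proof.
move=> dX dY XH YH rX rY; apply: contrapT => XY0.
have [dH [_ HM _]] := defH.
have nX (Z : set G) : definable1 Z -> Z `<=` H -> ~ rank1_ge Z r.+1.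
  by move=> dZ ZH /(rank1_ge_sub rkG dZ dH ZH).
have [A [dA AX rA indA]] := indecomposable_subset dX rX (nX X dX XH).
have [B [dB BY rB indB]] := indecomposable_subset dY rY (nX Y dY YH).
pose P g x := B g /\ A x.
pose Q g x := B g /\ A x /\ ~ A (g * x).
pose R g x := B g /\ A x /\ ~ B (g * x).
have dP : definable2 P by rewrite /P; def_tac.
have dQ : definable2 Q by rewrite /Q; def_tac.
have dR : definable2 R by rewrite /R; def_tac.
have rP : rank2_ge P (r + r)%N.
  apply: (rank2_fibers_ge rkG dP dB) rB => g Bg.
  by rewrite (_ : P g = A) //; apply/seteqP; split=> x; [case|split].
(* If the sections have rank below [r], a total rank of [r + r] forces rank [r.+1] on the base. *)
have smallf (S : G -> set G) : definable2 S -> (forall y, ~ rank1_ge (S y) r) ->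
    forall y i, rank1_ge (S y) i -> (i + r.+1 <= r + r)%N.
  move=> dS rS y i rSi; rewrite addnS -addSn leq_add2r ltnNge.
  by apply/negP => ri; apply: (rS y); apply: rank1_ge_leq rSi.
have [g x [Bg Ax]||] := rank2_geU_sub dQ dR dP _ rP.
- have [AB|nAB] := pselect (A (g * x)); [right|by left].
  do 2!split=> //; move=> Bgx; apply: XY0; exists (g * x).
  by split; [apply: AX | apply: BY].
- move=> rQ; apply: (nX B dB (fun x Bx => YH x (BY x Bx))).
  apply: (rank2_fibers_le rkG dQ dB _ (smallf Q dQ _) rQ) => [g x []//|g rQg].
  have [[x [Bg _]] _] := iffLR (rank1_geE rk _ _) rQg.
  apply: (indecomposable_left_invariant dA _ rA indA (YH _ (BY _ Bg))).
    by move=> y /AX/XH.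
  apply: (rank1_ge_sub rkG) rQg; [exact: (definable_section dQ) | by def_tac |].
  by move=> y [].
- move=> /(rank2_swap rkG dR) rR; apply: (nX A dA (fun x Ax => XH x (AX x Ax))).
  have dR' : definable2 (fun x g => R g x) by rewrite /R; def_tac.
  apply: (rank2_fibers_le rkG dR' dA _ (smallf _ dR' _) rR) => [x g [_ []]//|x rRx].
  have [[g [_ [Ax _]]] _] := iffLR (rank1_geE rk _ _) rRx.
  apply: (indecomposable_right_invariant dB _ rB indB (XH _ (AX _ Ax))).
    by move=> y /BY/YH.
  apply: (rank1_ge_sub rkG) rRx; [exact: (definable_section dR') | by def_tac |].
  by move=> y [? []].
Qed.

Lemma generic_setI (X Y : set G) : definable1 X -> definable1 Y ->
  X `<=` H -> Y `<=` H -> rank1_ge X r -> rank1_ge Y r -> rank1_ge (X `&` Y) r.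
Proof.
move=> dX dY XH YH rX rY.
have dXY : definable1 (X `&` Y) by def_tac.
have dX' : definable1 (X `\` Y) by def_tac.
have [|//|rX'] := rank1_geU_sub rkG dXY dX' dX _ rX.
  by move=> x Xx; have [Yx|nYx] := pselect (Y x); [left|right].
have [|x [[_ nY] Yx]] := generic_meet dX' dY _ YH rX' rY; last by case: nY.
by move=> x [/XH].
Qed.

End ConnectedGroup.
End GenericSets.

(** * Nilpotent groups *)

Section Commutators.
Variable G : groupType.
Implicit Types x y z : G.

Lemma commMgl x y z : [~ x * y, z] = [~ x, z] ^ y * [~ y, z].
Proof. by rewrite /commg /conjg !gnorm. Qed.

Lemma commMgr x y z : [~ x, y * z] = [~ x, z] * [~ x, y] ^ z.
Proof. by rewrite /commg /conjg !gnorm. Qed.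

Lemma commVgl x y : [~ x^-1, y] = [~ x, y]^-1 ^ x^-1.
Proof. by rewrite /commg /conjg !gnorm. Qed.

Lemma commVgr x y : [~ x, y^-1] = [~ x, y]^-1 ^ y^-1.
Proof. by rewrite /commg /conjg !gnorm. Qed.

Lemma conjg_commg x y : x ^ y = x * [~ x, y].
Proof. by rewrite /commg mulVKg. Qed.

End Commutators.

Definition normal_in (G : groupType) (D B : set G) :=
  forall b d, B b -> D d -> B (b ^ d).

(** For [B] normal in [D], the preimage in [D] of the centre of [D / B]. *)
Definition center_mod (G : groupType) (D B : set G) :=
  [set d | D d /\ forall e, D e -> B [~ d, e]].

Definition upper_central (G : groupType) (D : set G) i :=
  iter i (center_mod D) [set 1].

Section CenterMod.
Variables (G : groupType) (D B : set G).
Hypotheses (sD : subgroup D) (sB : subgroup B) (nB : normal_in D B).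

Lemma subgroupJ x y : D x -> D y -> D (x ^ y).
Proof.
have [_ DM DV] := sD; move=> Dx Dy; rewrite /conjg.
by apply: (DM); [exact: DV | exact: DM].
Qed.

(** Both minimality properties of [D], as a definable hull and as a connected group, are later
    applied to subgroups of this form. *)
Lemma subgroup_comm_preimage a : subgroup [set d | D d /\ B [~ a, d]].
Proof.
have [D1 DM DV] := sD; have [B1 BM BV] := sB; split=> [|x y [Dx Bx] [Dy By]|x [Dx Bx]].
- by rewrite /= commg1.
- split; first exact: DM.
  by rewrite commMgr; apply: BM => //; apply: nB.
- split; first exact: DV.
  by rewrite commVgr; apply: nB; [exact: BV | exact: DV].
Qed.

Lemma subgroup_center_mod : subgroup (center_mod D B).
Proof.
have [D1 DM DV] := sD; have [B1 BM BV] := sB; split=> [|x y [Dx Bx] [Dy By]|x [Dx Bx]].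
- by split=> // e De; rewrite comm1g.
- split; first exact: DM.
  by move=> e De; rewrite commMgl; apply: BM; [apply: nB => //; exact: Bx | exact: By].
- split; first exact: DV.
  by move=> e De; rewrite commVgl; apply: nB; [apply/BV/Bx | exact: DV].
Qed.

Lemma normal_center_mod : normal_in D (center_mod D B).
Proof.
have [D1 DM DV] := sD; move=> x d [Dx Bx] Dd; split; first exact: subgroupJ.
move=> e De; rewrite -(conjgKV d e) -conjRg; apply: nB => //; apply: Bx.
by apply: subgroupJ => //; apply: DV.
Qed.

Lemma normal_sub_center_mod B' :
  subgroup B' -> B `<=` B' -> B' `<=` center_mod D B -> normal_in D B'.
Proof.
move=> [_ BM _] BB' B'Z b d Bb Dd; rewrite conjg_commg; apply: BM => //.
by apply: BB'; have [_] := B'Z _ Bb; apply.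
Qed.

End CenterMod.

Lemma subgroupI (G : groupType) (H K : set G) :
  subgroup H -> subgroup K -> subgroup (H `&` K).
Proof.
move=> [H1 HM HV] [K1 KM KV]; split=> // [x y [? ?] [? ?]|x [? ?]].
  by split; [apply: HM | apply: KM].
by split; [apply: HV | apply: KV].
Qed.

Lemma subgroup1 (G : groupType) : subgroup [set (1 : G)].
Proof. by split=> // [_ _ -> ->|_ ->]; rewrite /= ?mulg1 ?invg1. Qed.

Lemma normal_in1 (G : groupType) (D : set G) : normal_in D [set 1].
Proof. by move=> _ d -> _; rewrite /= conj1g. Qed.

Section Nilpotent.
Variables (G : groupType) (L : language) (I : interpretation L G).

Lemma definable1_one : definable1 I [set (1 : G)].
Proof. by def_tac. Qed.

Lemma definable_center_mod (D B : set G) :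
  definable1 I D -> definable1 I B -> definable1 I (center_mod D B).
Proof. by move=> dD dB; rewrite /center_mod; def_tac. Qed.

Lemma upper_central_props (D : set G) i : definable_subgroup I D ->
  definable_subgroup I (upper_central D i) /\ normal_in D (upper_central D i).
Proof.
move=> [dD sD]; elim: i => [|i [[dU sU] nU]].
  by split; [split; [exact: definable1_one | exact: subgroup1] | exact: normal_in1].
split; last exact: normal_center_mod.
by split; [exact: definable_center_mod | exact: subgroup_center_mod].
Qed.

(** The lower central series of [K] is compared with the upper one of [D], whose terms are
    definable. For fixed [a], the [d] with [[~ a, d]] in a given term form a definable subgroup,
    which contains [D] as soon as it contains [K]. *)
Lemma upper_central_hull (K D : set G) : nilpotent K -> is_definable_hull I K D ->
  exists c, D `<=` upper_central D c.
Proof.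
move=> [c Kc] [defD KD minD]; have [dD sD] := defD; exists c.
suff lcU i : (i <= c)%N -> lower_central K (c - i) `<=` upper_central D i.
  have [defU _] := upper_central_props c defD.
  by apply: minD => //; have := lcU c (leqnn c); rewrite subnn.
have lcD j : lower_central K j `<=` D.
  elim: j => [//|j IH]; apply: smallest_sub => // _ [x Kx [y Ky <-]].
  have [_ DM DV] := sD; have Dx := IH _ Kx; have Dy := KD _ Ky.
  by rewrite /commg /conjg; do !apply: (DM) => //; apply: DV.
elim: i => [|i IH] ic; first by rewrite subn0 Kc.
have [[dU sU] nU] := upper_central_props i defD.
move=> a aK; split; first exact: lcD aK.
suff : D `<=` [set d | D d /\ upper_central D i [~ a, d]] by move=> h e /h[].
apply: minD; first split.
- by def_tac.
- exact: subgroup_comm_preimage.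
- move=> k Kk; split; first exact: KD.
  apply: (IH (ltnW ic)).
  rewrite -(subnSK ic); apply: sub_gen_smallest; exists a => //; by exists k.
Qed.

(* The groups [B k] form a chain of normal subgroups of [D] inside [M] with
   [B k.+1] of finite index in the centre [Z k] of [D] modulo [B k].  As [D] has
   no proper definable subgroup of finite index, the finite sections
   [Z k / B k.+1] are skipped and [Z] still dominates the upper central series. *)
Lemma connected_nilpotent_sub (D M : set G) x c :
  definable_subgroup I D -> definably_connected I D -> D `<=` upper_central D c ->
  definable_subgroup I M -> D x -> M x ->
  (forall Z, subgroup Z -> Z `<=` D -> (forall z, Z z -> M (x ^ z)) ->
    finite_index Z (Z `&` M)) ->
  D `<=` M.
Proof.
move=> [dD sD] [_ _ _ minD] Dc [dM sM] Dx Mx fixM.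
have [D1 DM DV] := sD; have [M1 MM MV] := sM.
pose B := fix B k := if k is k'.+1 then center_mod D (B k') `&` M else [set 1].
pose Z k := center_mod D (B k).
have BP k : [/\ definable1 I (B k), subgroup (B k), normal_in D (B k),
    B k `<=` M & B k `<=` D].
  elim: k => [|k [dB sB nB BM BD]].
    split; [exact: definable1_one | exact: (subgroup1 G) | exact: normal_in1 | |].
      by move=> _ ->.
    by move=> _ ->.
  have dZ := definable_center_mod dD dB; have sZ := subgroup_center_mod sD sB nB.
  have sBS := subgroupI sZ sM.
  split=> //; first by rewrite /=; def_tac.
  - apply: (normal_sub_center_mod (B := B k)) => // [b Bb|b [] //].
    split; last exact: BM.
    split; first exact: BD.
    have [_ BMM BV] := sB.
    by move=> e De; rewrite commgEl; apply: BMM; [exact: BV | exact: nB].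
  - by move=> b [].
  - by move=> b [[]].
have BZ k : B k `<=` B k.+1.
  have [_ [_ BM BV] nB sBM BD] := BP k => b Bb; split; last exact: sBM.
  split; first exact: BD.
  by move=> e De; rewrite commgEl; apply: BM; [exact: BV | exact: nB].
have sZ k : subgroup (Z k) by have [_ ? ? _ _] := BP k; apply: subgroup_center_mod.
(* Modulo [B k], elements of [Z k] commute with [x]; as [B k] lies in [M], they conjugate [x] into
   [M], which is what [fixM] asks. *)
have finZ k : finite_index (Z k) (B k.+1).
  have [_ [_ _ BV] _ BM _] := BP k.
  apply: fixM => // [z []//|z [Dz Bz]].
  by rewrite conjg_commg; apply: MM => //; apply: BM; rewrite -invgR; apply/BV/Bz.
have UZ i : upper_central D i `<=` Z i.
  elim: i => [|i IH]; first by move=> _ ->; have [] := sZ 0%N.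
  have [dB sB nB BM BD] := BP i.+1; have [B1 BMM BV] := sB.
  move=> a [Da Ua]; split=> //.
  suff : D `<=` [set d | D d /\ B i.+1 [~ a, d]] by move=> h e /h[].
  apply: minD; first split.
  - by move: (B i.+1) dB => C dC; def_tac.
  - exact: subgroup_comm_preimage.
  - by move=> d [].
  (* As [[~ a, d]] lies in [Z i], it takes finitely many values modulo [B i.+1]. *)
  apply: (finite_index_map (f := fun d => [set [~ a, d] * b | b in B i.+1])).
  - exact: subgroup_comm_preimage.
  - apply: sub_finite_set (finZ i) => _ [d Dd <-]; exists [~ a, d] => //.
    by apply: IH; apply: Ua.
  move=> d e Dd De /seteqP[_ /(_ [~ a, e])][|b Bb eb]; first by exists 1; rewrite ?mulg1.
  have De' : D (d^-1 * e) by apply: DM => //; apply: DV.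
  have [_ _ ZV] := sZ i; have [Du Zu] := ZV _ (IH _ (Ua d Dd)).
  (* With [[~ a, e] = [~ a, d] * b], the commutator of [a] and [d^-1 * e] is a conjugate of [b]
     times a commutator of [[~ a, d]^-1], an element of [Z i], with [d^-1 * e]; the latter is in
     [B i]. *)
  split=> //; rewrite commMgr commVgr -conjgM conjg_commg -eb mulgA.
  have -> : [~ a, d] * b * [~ a, d]^-1 = b ^ [~ a, d]^-1 by rewrite /conjg invgK mulgA.
  by apply: BMM; [apply: nB | apply/BZ/Zu].
have DZ : D `<=` Z c by move=> d /Dc /UZ.
(* [B c.+1] has finite index in [Z c], which is now all of [D]. *)
have DM' : D `<=` B c.+1.
  apply: minD; first by have [dB sB _ _ _] := BP c.+1.
    by have [] := BP c.+1.
  have -> // : D = Z c by apply/seteqP; split=> // d [].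
by move=> d /DM'[].
Qed.

End Nilpotent.

(** * Generosity *)

Section Cosets.
Variables (G : groupType) (L : language) (I : interpretation L G).
Variables (rk : rank_function G) (rkG : borovik_poizat I rk).

Local Notation rank1_ge := (rank1_ge rk).
Local Notation rank2_ge := (rank2_ge rk).
Local Notation definable1 := (definable1 I).
Local Notation definable2 := (definable2 I).

Definition conj_union (X : set G) := [set x | exists g, X (g * x * g^-1)].

Lemma conj_unionE (X : set G) : \bigcup_(g in [set: G]) conj_set X g = conj_union X.
Proof.
apply/seteqP; split=> [x [g _ [y Xy <-]]|x [g Xg]].
  by exists g; rewrite /conjg !mulgA mulgV mul1g mulgK.
by exists g => //; exists (g * x * g^-1); rewrite // /conjg mulgVK mulKg.
Qed.

Lemma definable_conj_union (X : set G) : definable1 X -> definable1 (conj_union X).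
Proof. by move=> dX; rewrite /conj_union; def_tac. Qed.

Lemma rank1_ge_top (X : set G) : X !=set0 -> rank1_ge X (rank1 rk X).
Proof. by move=> X0; apply/rank1_geE. Qed.

Lemma rank1_ge_topS (X : set G) : ~ rank1_ge X (rank1 rk X).+1.
Proof. by move/rank1_geE=> -[_]; rewrite ltnn. Qed.

Lemma rank1_ge_conj (X : set G) g k : definable1 X ->
  rank1_ge [set x | X (g * x * g^-1)] k -> rank1_ge X k.
Proof.
move=> dX; apply: (rank1_ge_map rkG (f := fun x => g^-1 * x * g)) => //.
- by tdef_tac.
- by def_tac.
- by move=> y Xy; exists (g * y * g^-1); rewrite // !mulgA mulVg mul1g mulgVK.
Qed.

Local Notation s := (rank1 rk [set: G]).

(** Double counting of the pairs [(x, g)] with [g * x * g^-1] in [V]: counted over [x] they have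
    rank at least [s + r], while each section over [g] is a conjugate of [V]. *)
Lemma rank_conj_union (V : set G) r : definable1 V -> rank1_ge (conj_union V) s ->
  (forall x, conj_union V x -> rank1_ge [set g | V (g * x * g^-1)] r) ->
  rank1_ge V r.
Proof.
move=> dV sV Vr; apply: contrapT => rV.
pose P x := [set g | V (g * x * g^-1)].
have dP : definable2 P by rewrite /P; def_tac.
have dP' : definable2 (fun g x => P x g) by rewrite /P; def_tac.
have rP := rank2_fibers_ge rkG dP (definable_conj_union dV) Vr sV.
apply: (@rank1_ge_topS [set: G]).
apply: (rank2_fibers_le rkG dP' (definable1_setT I) _ _ (rank2_swap rkG dP rP)) => // g i rg.
have {rg} ri := rank1_ge_conj dV rg.
rewrite addnS -addSn addnC leq_add2l ltnNge; apply/negP => /rank1_ge_leq h.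
exact/rV/(h _ _ _ ri).
Qed.

(* For a group [N], the inner set is the union of the cosets [N g] such that [x]
   lies in [N ^ g]; it has larger rank than [N] when there are infinitely many. *)
Lemma rank_conjugates_containing (N : set G) k : definable1 N -> ~ rank1_ge N k ->
  ~ rank1_ge [set x | rank1_ge [set g | N (g * x * g^-1)] k] s.
Proof.
move=> dN kN sF.
pose P x := [set g | N (g * x * g^-1)].
have dP : definable2 P by rewrite /P; def_tac.
have dP' : definable2 (fun g x => P x g) by rewrite /P; def_tac.
have rP := rank2_fibers_ge rkG dP (definable_rank1_ge rkG dP k) (fun x => id) sF.
apply: (@rank1_ge_topS [set: G]).
apply: (rank2_fibers_le rkG dP' (definable1_setT I) _ _ (rank2_swap rkG dP rP)) => // g i rg.
have {rg} ri := rank1_ge_conj dN rg.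
rewrite addnS -addSn addnC leq_add2l ltnNge; apply/negP => /rank1_ge_leq h.
exact/kN/(h _ _ _ ri).
Qed.

(** Otherwise the conjugates of the complement [V] of [Y] in [H] would form a generic set. Since [V]
    is invariant under conjugation by [H], each [x] in [V ^ g] would be conjugated into [V] by the
    whole coset [H g], which forces [V] to have the rank of [H], against connectedness. *)
Lemma generous_of_generic (H Y : set G) :
  definable_subgroup I H -> definably_connected I H -> generous I rk H ->
  definable1 Y -> Y `<=` H -> normal_in H Y -> rank1_ge Y (rank1 rk H) ->
  rank1_ge (conj_union Y) s.
Proof.
move=> defH connH genH dY YH nY rY; have [dH [H1 HM HV]] := defH.
have [_ _ X0 sH] := genH; rewrite conj_unionE in X0 sH.
have {X0 sH} sH : rank1_ge (conj_union H) s by rewrite -sH; exact: rank1_ge_top.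
pose V := H `\` Y; have dV : definable1 V by rewrite /V; def_tac.
have [|//|sV] := rank1_geU_sub rkG (definable_conj_union dY)
    (definable_conj_union dV) (definable_conj_union dH) _ sH.
  move=> x [g Hg]; have [Yg|nYg] := pselect (Y (g * x * g^-1)); [left|right].
    by exists g.
  by exists g.
have rV : ~ rank1_ge V (rank1 rk H).
  move=> rV; have VH : V `<=` H by move=> x [].
  have [x [[_ nYx] Yx]] :=
    generic_meet rkG defH connH (@rank1_ge_topS H) dV dY VH YH rV rY.
  exact: nYx.
case: rV; apply: rank_conj_union dV sV _ => x [g [Hg nYg]].
apply: (rank1_ge_map rkG (f := fun k => k * g^-1)) (rank1_ge_top _).
- by tdef_tac.
- by rewrite /V; def_tac.
- exact: dH.
- move=> h Hh; exists (h * g); rewrite ?mulgK //.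
  have e : h * g * x * (h * g)^-1 = (g * x * g^-1) ^ h^-1.
    by rewrite /conjg invgM invgK !mulgA.
  rewrite /= e; split; first by apply: subgroupJ => //; apply: HV.
  by move/nY => /(_ h Hh); rewrite conjgKV.
by exists 1.
Qed.

End Cosets.

(** * The extension of [H] by [w] *)

Lemma bounded_collision (c : nat -> nat) n : (forall i, (c i < n)%N) ->
  exists i j, i <> j /\ c i = c j.
Proof.
move=> cn; apply: contrapT => injc.
have : (n.+1 <= n)%N; last by rewrite ltnn.
apply: (pigeonhole (f := c)) => [i j _ _ cij|_ [i _ <-]]; last exact: cn.
by apply: contrapT => ij; apply: injc; exists i, j.
Qed.

Lemma subgroupX (G : groupType) (H : set G) x n : subgroup H -> H x -> H (x ^+ n).
Proof.
move=> [H1 HM _] Hx; elim: n => [|n IH]; first by rewrite expg0.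
by rewrite expgS; apply: HM.
Qed.

(** The union of the cosets [w ^+ i * H]. Natural exponents suffice to get a group when a positive
    power of [w] lies in [H]. *)
Definition cyclic_extension (G : groupType) (H : set G) (w : G) :=
  [set x | exists i, H ((w ^+ i)^-1 * x)].

Section CyclicExtension.
Variables (G : groupType) (H : set G) (w : G) (n : nat).
Hypotheses (sH : subgroup H) (cwH : forall h, H h -> commute w h).
Hypotheses (n_gt0 : (0 < n)%N) (wnH : H (w ^+ n)).

Let cwV k h : H h -> (w ^+ k)^-1 * h = h * (w ^+ k)^-1.
Proof. by move=> Hh; apply/commute_sym/commuteV/commuteX/commute_sym/cwH. Qed.

Lemma cyclic_extensionP x :
  cyclic_extension H w x <-> exists2 i, (i < n)%N & H ((w ^+ i)^-1 * x).
Proof.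
split=> [[i Hx]|[i _ Hx]]; last by exists i.
have [H1 HM HV] := sH; exists (i %% n)%N; first exact: ltn_pmod.
have -> : (w ^+ (i %% n))^-1 * x = (w ^+ n) ^+ (i %/ n) * ((w ^+ i)^-1 * x).
  have iE := divn_eq i n; move: (i %/ n)%N (i %% n)%N iE => q m ->.
  by rewrite addnC expgnDr mulnC expgnA invgM -mulgA mulVKg.
by apply: HM => //; apply: subgroupX.
Qed.

Lemma sub_cyclic_extension : H `<=` cyclic_extension H w.
Proof. by move=> h Hh; exists 0%N; rewrite expg0 invg1 mul1g. Qed.

Lemma subgroup_cyclic_extension : subgroup (cyclic_extension H w).
Proof.
have [H1 HM HV] := sH; split=> [|x y [i Hx] [j Hy]|x [i Hx]].
- exact: sub_cyclic_extension.
- exists (i + j)%N; move: Hx; rewrite -[in x * y](mulVKg (w ^+ i) x).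
  move: (_^-1 * x) => h Hh; rewrite expgnDr invgM -!mulgA mulKg mulgA cwV // -mulgA.
  exact: HM.
(* The inverse of [w ^+ i] is [w ^+ (i * n.-1)] up to a power of [w ^+ n], which lies in [H]. *)
- exists (i * n.-1)%N; move: Hx; rewrite -{2}[x](mulVKg (w ^+ i)).
  move: (_^-1 * x) => h Hh; rewrite invgM mulgA cwV; last exact: HV.
  rewrite -mulgA -invgM -expgnDr -{1}(muln1 i) -mulnDr add1n prednK // mulnC expgnA.
  by apply: HM; apply: HV => //; apply: subgroupX.
Qed.

End CyclicExtension.

(** * The generic type *)

Section Saturation.
Variables (G : groupType) (L : language) (I : interpretation L G).
Variables (rk : rank_function G) (rkG : borovik_poizat I rk).

Local Notation rank1_ge := (rank1_ge rk).
Local Notation definable1 := (definable1 I).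

Lemma generic_inP (X A : set G) : definable1 A -> A !=set0 ->
  generic_in I rk X A <-> [/\ definable1 X, X `<=` A & rank1_ge X (rank1 rk A)].
Proof.
move=> dA A0; split=> [[dX XA X0 e]|[dX XA rX]].
  by split=> //; apply/rank1_geE; rewrite e.
have [X0 le] := iffLR (rank1_geE _ _ _) rX; split=> //.
apply/eqP; rewrite eqn_leq le andbT.
have [] // : A !=set0 /\ (rank1 rk X <= rank1 rk A)%N.
by apply/rank1_geE; apply: (rank1_ge_sub rkG dX dA XA); apply/rank1_geE.
Qed.

(** Hilbert's hotel along a sequence [e] in [A]: its terms move by [n] places and the elements of
    [F] outside [A] take the first [n]. *)
Lemma card_setU_finite (A F : set G) : infinite_set A -> finite_set F ->
  A `|` F #<= A.
Proof.
move=> /infinite_enum[e [injE Ae]] [n /card_eqPle[/pcard_leP[idx] _]].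
have idxn x : F x -> (idx x < n)%N by move=> Fx; have := @funS _ _ _ _ idx x Fx.
have idxI x y : F x -> F y -> idx x = idx y -> x = y.
  by move=> Fx Fy; apply: (@inj _ _ _ idx); rewrite inE.
have [inv invE] : exists inv : G -> nat, forall k, inv (e k) = k.
  have /choice[inv Hinv] : forall x, exists k, (exists k', e k' = x) -> e k = x.
    move=> x; have [[k ek]|nk] := pselect (exists k', e k' = x); first by exists k.
    by exists 0%N => /nk.
  by exists inv => k; apply: injE; apply: Hinv; exists k.
pose f x := if `[< A x >] then
  (if `[< range e x >] then e (inv x + n)%N else x) else e (idx x).
suff [g] : $|{injfun (A `|` F) >-> A}| by exact: inj_card_le.
apply/injfunPex; exists f => [x _|x y]; rewrite /f.
  by case: asboolP => [Ax|_]; [case: asboolP => // _|]; apply: Ae.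
rewrite !inE => AFx AFy.
have ne k z : ~ range e z -> e k <> z by move=> nz ek; apply: nz; exists k.
case: (asboolP (A x)) => [Ax|nAx]; case: (asboolP (A y)) => [Ay|nAy].
- case: (asboolP (range e x)) => [[k _ <-]|/ne nx];
    case: (asboolP (range e y)) => [[l _ <-]|/ne ny] //.
  + by rewrite !invE => /injE/addIn ->.
  + by move/ny.
  + by move/esym/nx.
- have Fy : F y by case: AFy.
  case: asboolP => [_ /injE eI|/ne nx /esym/nx//].
  by have := idxn y Fy; rewrite -eI ltnNge leq_addl.
- have Fx : F x by case: AFx.
  case: asboolP => [_ /injE eI|/ne ny /ny//].
  by have := idxn x Fx; rewrite eI ltnNge leq_addl.
- by move/injE; apply: idxI; [case: AFx | case: AFy].
Qed.

Lemma small_setU (A F : set G) : infinite_set [set: G] -> finite_set F ->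
  small A -> small (A `|` F).
Proof.
move=> infG finF smA leG; apply: smA.
have infA : infinite_set A.
  move=> finA; apply: infG; apply: card_le_finite leG _.
  by rewrite finite_setU.
exact: card_le_trans leG (card_setU_finite infA finF).
Qed.

Hypothesis connG : definably_connected I [set: G].
Local Notation s := (rank1 rk [set: G]).

Let T0 : [set: G] !=set0. Proof. by exists 1. Qed.

Lemma generic_setIT (X Y : set G) : definable1 X -> definable1 Y ->
  rank1_ge X s -> rank1_ge Y s -> rank1_ge (X `&` Y) s.
Proof.
have [defG _ _ _] := connG.
by move=> dX dY; apply: (generic_setI rkG defG connG (@rank1_ge_topS _ rk setT)).
Qed.

Lemma definable1_formula (A : set G) (phi : formula L A 1) :
  definable1 [set x | holds I phi [tuple x]].
Proof.
have [F [_ _ /(_ _ (@subsetT _ F))]] := formula_params I phi.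
by rewrite /Defs.definable1 tuples1E; congr definable_over; apply: funext => e /=;
  congr holds; apply: eq_from_tnth => i; rewrite ord1.
Qed.

Lemma finite_generic_setI T (q : set T) (X : T -> set G) : finite_set q ->
  (forall t, q t -> definable1 (X t) /\ rank1_ge (X t) s) ->
  exists x, forall t, q t -> X t x.
Proof.
move=> [n /card_eqPle[/pfcard_geP[->|[f]] _]] HX; first by exists 1.
have qf i : (i < n)%N -> q (f i) by move=> iN; apply: (@funS _ _ `I_n q f).
have [Y [_ rY YX]] : exists Y, [/\ definable1 Y, rank1_ge Y s &
    forall y i, Y y -> (i < n)%N -> X (f i) y].
  elim: n {f}(f : nat -> T) qf => [|n IH] f qf.
    by exists setT; split=> //; [exact: definable1_setT | exact: rank1_ge_top].
  have [Y [dY rY YX]] := IH f (fun i iN => qf i (ltnW iN)).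
  have [dXn rXn] := HX _ (qf n (ltnSn n)).
  exists (Y `&` X (f n)); split; first by move: (X (f n)) dXn => Z dZ; def_tac.
    exact: generic_setIT.
  by move=> y i [Yy Xy]; rewrite ltnS leq_eqVlt => /predU1P[->//|]; exact: YX.
have [[y Yy] _] := iffLR (rank1_geE rk _ _) rY; exists y => t qt.
by have [i iN <-] := @surj _ _ `I_n q f t qt; apply: YX.
Qed.

Lemma complete_generic_type (A : set G) : complete_type I (@generic_type G L I rk A).
Proof.
split=> [q qp finq|phi].
  have [|x Hx] := finite_generic_setI
    (X := fun phi => [set x | holds I phi [tuple x]]) finq.
    by move=> phi /qp /(iffLR (generic_inP _ (definable1_setT I) T0))[].
  by exists [tuple x].
have dphi := definable1_formula phi; have dnphi := definable1_formula (FNot phi).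
have [|h|h] := rank1_geU_sub rkG dphi dnphi (definable1_setT I) _ (rank1_ge_top rk T0).
- by move=> x _; have [h|h] := pselect (holds I phi [tuple x]); [left|right].
- by left; apply/(generic_inP _ (definable1_setT I) T0).
- by right; apply/(generic_inP _ (definable1_setT I) T0).
Qed.

(** [X] may need parameters outside [A]. Adding its finitely many parameters keeps the set small,
    and a realization of the generic type over the larger set realizes the one over [A], because
    genericity of a definable set does not depend on the formula chosen for it. *)
Lemma saturated_generic (A X : set G) : saturated I -> infinite_set [set: G] ->
  small A -> definable1 X -> rank1_ge X s ->
  exists x, X x /\ realizes I (@generic_type G L I rk A) [tuple x].
Proof.
move=> sat infG smA [psi Xpsi] rX.
have dX : definable1 X by exists psi.
have [F [finF _ FX]] := formula_params I psi.
have smB := small_setU infG finF smA.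
have [e He] := sat _ _ _ smB (@complete_generic_type (A `|` F)).
exists (tnth e ord0).
have eE : e = [tuple tnth e ord0] by apply: eq_from_tnth => i; rewrite ord1.
have in_gen (phi : formula L (A `|` F) 1) : rank1_ge [set x | holds I phi [tuple x]] s ->
    holds I phi e.
  move=> rphi; apply: He; apply/(generic_inP _ (definable1_setT I) T0).
  by split=> //; exact: definable1_formula.
split.
  have [phi ephi] := FX (A `|` F) (@subsetUr _ _ _).
  have Xphi x : X x <-> holds I phi [tuple x].
    rewrite -[holds I phi _]/([set e | holds I phi e] [tuple x]) -ephi -Xpsi.
    by rewrite tuples1E.
  apply/Xphi; rewrite -eE; apply: in_gen.
  by rewrite (_ : [set x | _] = X) //; apply/seteqP; split=> x /Xphi.
move=> chi chi_gen; have [F' [_ F'A]] := formula_params I chi.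
move=> /(_ (A `|` F) (subset_trans F'A (@subsetUl _ _ _)))[phi ephi].
have Hphi y : holds I chi y <-> holds I phi y.
  by rewrite -[holds I phi _]/([set e | holds I phi e] y) -ephi.
rewrite -eE; apply/Hphi/in_gen.
have [_ _ rchi] := iffLR (generic_inP _ (definable1_setT I) T0) chi_gen.
rewrite (_ : [set x | _] = [set x | holds I chi [tuple x]]) //.
by apply/seteqP; split=> x /Hphi.
Qed.

End Saturation.

(** * Conjugates of the coset of [w] *)

Section NormalizingCosets.
Variables (G : groupType) (L : language) (I : interpretation L G).
Variables (rk : rank_function G) (rkG : borovik_poizat I rk).
Variables (H : set G) (w : G) (n : nat).
Hypotheses (defH : definable_subgroup I H) (cwH : forall h, H h -> commute w h).
Hypotheses (n_gt0 : (0 < n)%N) (wnH : H (w ^+ n)) (nwH : ~ H w).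

Local Notation rank1_ge := (rank1_ge rk).
Local Notation definable1 := (definable1 I).
Local Notation s := (rank1 rk [set: G]).
Local Notation r := (rank1 rk H).
Local Notation N := (cyclic_extension H w).

Let dH : definable1 H. Proof. by case: defH. Qed.
Let sH : subgroup H. Proof. by case: defH. Qed.
Let NP := cyclic_extensionP sH n_gt0 wnH.

Lemma definable_cyclic_extension : definable_subgroup I N.
Proof.
split; last exact: subgroup_cyclic_extension n_gt0 wnH.
apply/definable1P.
have dN : pdef I (fun e : 1.-tuple G =>
    exists2 i, (i < n)%N & H ((w ^+ i)^-1 * tnth e ord0)).
  by apply: (pdef_ex_lt (P := fun i e => H ((w ^+ i)^-1 * tnth e ord0))) => i; pdef_tac.
by apply: pdefE dN => e; rewrite NP.
Qed.

Lemma rank_cyclic_extension : ~ rank1_ge N r.+1.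
Proof.
have [dN _] := definable_cyclic_extension => rN.
have dC i : definable1 [set x | H ((w ^+ i)^-1 * x)] by def_tac.
have [i _ rNi] := rank1_ge_cover rkG dN dC (fun x => iffLR (NP x)) rN.
apply: (@rank1_ge_topS _ rk H).
apply: (rank1_ge_map rkG (f := fun x => w ^+ i * x)) rNi => //.
- by tdef_tac.
- by have dNi := dC i; move: [set x | _] dNi => C dNi; def_tac.
- by move=> y [_ Hy]; exists ((w ^+ i)^-1 * y); rewrite ?mulVKg.
Qed.

(** The threshold is one more than the rank of a single coset of [N]. *)
Definition in_many_conjugates := [set x | rank1_ge [set g | N (g * x * g^-1)] r.+1].

(** Elements of [Z] in distinct cosets of [M] place [x] in conjugates of [N] given by distinct
    cosets of [N]; infinitely many of these would put [x] in [in_many_conjugates]. *)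
Lemma finite_index_conjugate_part x g (Z M : set G) :
  ~ in_many_conjugates x -> subgroup Z -> subgroup M ->
  (forall z, M z <-> N (g * z * g^-1)) -> (forall z, Z z -> M (x ^ z)) ->
  finite_index Z (Z `&` M).
Proof.
move=> few sZ sM MN Zx; have [Z1 ZM ZV] := sZ.
have [dN sN] := definable_cyclic_extension; have [N1 NM NV] := sN.
apply: finite_index_seq => [|h Zh]; first exact: subgroupI.
apply: contrapT => dis; apply: few.
(* The pieces are the cosets of [N] through [g * (h i)^-1]. *)
apply: (rank1_geS rkG (B := fun i => [set k | N (k * h i * g^-1)])).
- by def_tac.
- move=> i; split; first by def_tac.
    move=> k /= Nk; set m := k * h i * g^-1 in Nk.
    have -> : k = m * (g * (h i)^-1) by rewrite /m !mulgA mulgVK mulgK.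
    have /MN Nx := Zx _ (Zh i).
    have -> : m * (g * (h i)^-1) * x * (m * (g * (h i)^-1))^-1 =
        m * (g * x ^ h i * g^-1) * m^-1 by rewrite /conjg !invgM invgK !mulgA.
    by apply: (NM); [exact: NM | exact: NV].
  apply: (rank1_ge_map rkG (f := fun k => k * h i * g^-1)) (rank1_ge_top rk _) => //.
  + by tdef_tac.
  + by def_tac.
  + move=> y Hy; exists (y * g * (h i)^-1); rewrite ?mulgVK ?mulgK //=.
    by rewrite mulgVK mulgK; apply: sub_cyclic_extension.
  + by exists 1; case: sH.
- move=> i j k Ni Nj; apply: contrapT => ij; apply: dis; exists i, j; split=> //.
  split; first by apply: ZM => //; apply: ZV.
  apply/MN; have := NM _ _ (NV _ Ni) Nj.
  by rewrite !invgM invgK !mulgA mulgVK.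
Qed.

Lemma coset_not_nilpotent x :
  ~ in_many_conjugates x -> conj_union [set y | H (w^-1 * y)] x ->
  ~ in_connected_nilpotent I x.
Proof.
move=> few [g wHx] [K [sK [D [hullD connD]] nilK Kx]].
have [[dD sD] KD minD] := hullD; have [c Dc] := upper_central_hull nilK hullD.
have [dN sN] := definable_cyclic_extension.
have conjS (X : set G) : subgroup X -> subgroup [set d | X (g * d * g^-1)].
  move=> [X1 XM XV]; split=> [|a b Xa Xb|a Xa] /=.
  - by rewrite mulg1 mulgV.
  - by have := XM _ _ Xa Xb; rewrite !mulgA mulgVK.
  - by have := XV _ Xa; rewrite !invgM invgK !mulgA.
pose M := [set d | N (g * d * g^-1)].
have sM : subgroup M by apply: conjS.
have DM : D `<=` M.
  apply: (connected_nilpotent_sub (x := x) (conj dD sD) connD Dc).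
  - by split=> //; rewrite /M; def_tac.
  - exact: KD.
  - by exists 1%N; rewrite expg1.
  - move=> Z sZ ZD Zx.
    exact: (finite_index_conjugate_part few sZ sM (fun z => iff_refl _) Zx).
(* Among more than [n] elements of [D], two have conjugates in the same coset [w ^+ k * H], so this
   subgroup has finite index in the connected group [D]. *)
have DH : D `<=` [set d | D d /\ H (g * d * g^-1)].
  have [_ _ _ minC] := connD.
  have sDH : subgroup [set d | D d /\ H (g * d * g^-1)].
    by apply: (subgroupI sD); apply: conjS.
  apply: minC; [split=> //; by def_tac | by move=> d [] |].
  apply: finite_index_seq => // h Dh.
  have Nh i : exists k, (k < n)%N /\ H ((w ^+ k)^-1 * (g * h i * g^-1)).
    by have /NP[k kn Hk] := DM _ (Dh i); exists k.
  have [k Hk] := choice Nh.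
  have [i [j [ij kij]]] := bounded_collision (fun i => (Hk i).1).
  exists i, j; split=> //; split.
    by have [_ DMul DV] := sD; apply: DMul => //; apply: DV.
  have [_ Hi] := Hk i; have [_ Hj] := Hk j; have [_ HM HV] := sH.
  have := HM _ _ (HV _ Hi) Hj.
  by rewrite kij !invgM !invgK !mulgA mulgK mulgVK.
have [_ Hx] := DH _ (KD _ Kx); apply: nwH; have [_ HM HV] := sH.
have := HM _ _ Hx (HV _ wHx); rewrite invgM invgK mulgA mulgV mul1g.
by [].
Qed.

(** The power map goes from the conjugates of the coset of [w] onto those of [Y], and being onto is
    enough to carry a lower bound on the rank back to its source. *)
Lemma coset_generous : definably_connected I H -> generous I rk H ->
  generic_in I rk (nth_powers H n) H ->
  rank1_ge (conj_union [set y | H (w^-1 * y)]) s.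
Proof.
move=> connH genH powH; have [H1 HM HV] := sH.
have [dP PH rP] := iffLR (generic_inP rkG _ dH (ex_intro _ 1 H1)) powH.
(* A translate of the set of [n]-th powers by an element of [H], hence still generic in [H]; it is
   normalized by [H] because [w ^+ n] commutes with [H]. *)
pose Y := [set y | nth_powers H n ((w ^+ n)^-1 * y)].
have dY : definable1 Y by move: (nth_powers H n) dP @Y => P dP Y; rewrite /Y; def_tac.
have cwn h : H h -> commute (w ^+ n)^-1 h.
  by move=> Hh; apply/commute_sym/commuteV/commuteX/commute_sym/cwH.
have rY : rank1_ge (conj_union Y) s.
  apply: (generous_of_generic rkG defH connH genH) => //.
  - by move=> y /PH /(HM _ _ wnH); rewrite mulVKg.
  - move=> y d [h Hh hy] Hd; exists (h ^ d); first exact: subgroupJ.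
    by rewrite -conjXg hy conjMg; congr (_ * _); rewrite /conjg cwn // mulKg.
  - apply: (rank1_ge_map rkG (f := fun y => (w ^+ n)^-1 * y)) rP => //.
      by tdef_tac.
    by move=> p Pp; exists (w ^+ n * p); rewrite /Y /= mulKg.
have dC : definable1 [set y | H (w^-1 * y)] by def_tac.
apply: (rank1_ge_map rkG (f := fun x => x ^+ n)) rY.
- by tdef_tac.
- exact: definable_conj_union.
- exact: definable_conj_union.
move=> y [g [h Hh hy]]; exists ((w * h) ^ g).
  by rewrite -conj_unionE; exists g => //; exists (w * h); rewrite //= mulKg.
rewrite -conjXg expgMn; last exact: cwH.
by rewrite hy mulVKg /conjg !mulgA mulgVK mulVg mul1g.
Qed.

End NormalizingCosets.

Theorem corollary2 (G : groupType) (L : language) (I : interpretation L G)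
    (rk : rank_function G) (rkG : borovik_poizat I rk)
    (connG : definably_connected I [set: G])
    (nilG : generically_connected_nilpotent I rk)
    (H : set G) (defH : definable_subgroup I H)
    (connH : definably_connected I H) (genH : generous I rk H)
    (w : G) (normw : (normalizer H `\` H) w)
    (n : nat) (ordw : has_order_mod H w n)
    (powH : generic_in I rk (nth_powers H n) H) :
  subgroup (centralizer_in H w) /\ centralizer_in H w `<` H.
Proof.
have [dH [H1 HM HV]] := defH.
split.
  split=> [|x y [Hx cx] [Hy cy]|x [Hx cx]].
  - by split; rewrite ?mul1g ?mulg1.
  - by split; [exact: HM | apply/commute_sym/commuteM; apply: commute_sym].
  - by split; [exact: HV | apply/commute_sym/commuteV/commute_sym].
split=> [h []//|HC].
have cwH h : H h -> commute w h by move=> /HC[_ /commute_sym].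
have [_ nwH] := normw; have [n_gt0 wnH _] := ordw.
have rW := coset_generous rkG defH cwH wnH connH genH powH.
set W := conj_union _ in rW.
have dW : definable1 I W.
  by apply: definable_conj_union; def_tac.
have [dN sN] := definable_cyclic_extension defH cwH n_gt0 wnH.
have rN := rank_cyclic_extension rkG defH cwH n_gt0 wnH.
pose F := in_many_conjugates rk H w.
have dP : definable2 I (fun x => [set g | cyclic_extension H w (g * x * g^-1)]).
  by move: (cyclic_extension H w) dN => N dN; def_tac.
have dF : definable1 I F := definable_rank1_ge rkG dP _.
have dX : definable1 I (W `\` F) by move: F dF W dW {rW} => F dF W dW; def_tac.
have rX : rank1_ge rk (W `\` F) (rank1 rk [set: G]).
  have [|//|rF] := rank1_geU_sub rkG dX dF dW _ rW.
    by move=> x Wx; have [Fx|nFx] := pselect (F x); [right|left].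
  by case: (rank_conjugates_containing rkG dN rN).
have not_nil x : (W `\` F) x -> ~ in_connected_nilpotent I x.
  by move=> [Wx nFx]; apply: (coset_not_nilpotent rkG defH cwH n_gt0 wnH nwH nFx Wx).
case: nilG => [[sat [A [smA Anil]]]|[X [genX Xnil]]]; last first.
  have T0 : [set: G] !=set0 by exists 1.
  have [dX' _ rX'] := iffLR (generic_inP rkG _ (definable1_setT I) T0) genX.
  have [[x [Xx WFx]] _] := iffLR (rank1_geE rk _ _)
    (generic_setIT rkG connG dX' dX rX' rX).
  exact: (not_nil x WFx (Xnil x Xx)).
(* A finite connected group is trivial, but [w] differs from 1, which lies in [H]. Infinity of [G]
   allows finitely many parameters to be added to a small set. *)
have infG : infinite_set [set: G].
  move=> finG; have [_ _ _ minG] := connG.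
  have : [set: G] `<=` [set 1].
    apply: minG => //; first by split; [exact: definable1_one | exact: subgroup1].
    apply: sub_finite_set (finite_image (fun x => [set x * k | k in [set 1]]) finG).
    by move=> _ [x _ <-]; exists x.
  by move=> /(_ w Logic.I) /= w1; apply: nwH; rewrite w1.
have [x [WFx xgen]] := saturated_generic rkG connG sat infG smA dX rX.
exact: (not_nil x WFx (Anil x xgen)).
Qed.
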